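(* Let $\mathfrak g$ be a finite-dimensional Lie algebra over a field $\mathbb K$ of characteristic zero. Let $(V,[\alpha])$ and $(W,[\beta])$ be two dg Loday–Pirashvili classes which are dg lifts of Loday–Pirashvili modules $(G,X)$ and $(H,Y)$, respectively, and suppose that $V$ is also a resolution of $G$. Then for every morphism of Loday–Pirashvili modules $\varphi\colon(G,X)\to(H,Y)$ there exists a unique morphism of dg Loday–Pirashvili classes $[f]\colon(V,[\alpha])\rightsquigarrow(W,[\beta])$ which is a dg lift of $\varphi$.
   Context: A dg $\mathfrak g$-module is a bounded cochain complex $(V^\bullet,d^V)$ of $\mathfrak g$-modules with $\mathfrak g$-equivariant differentials; $\Omega_{\mathfrak g}(V)=\wedge^\bullet\mathfrak g^\vee\otimes V$ (degree $p+q$ on $\wedge^p\mathfrak g^\vee\otimes V^q$) with total differential $d^V_{\mathrm{tot}}=d^V_{\mathrm{CE}}+d^V$, where $d^V_{\mathrm{CE}}$ is the Chevalley–Eilenberg differential and $d^V(\omega\otimes v)=(-1)^p\omega\otimes d^Vv$. A weak morphism $f\colon V\rightsquigarrow W$ is a degree $0$ $\Omega_{\mathfrak g}$-linear map $\Omega_{\mathfrak g}(V)\to\Omega_{\mathfrak g}(W)$ intertwining total differentials, with component $f_0^0\colon V^0\to W^0$; weak morphisms $f,f'$ are homotopic if $f'-f=d^W_{\mathrm{tot}}h+hd^V_{\mathrm{tot}}$ for some degree $-1$ $\Omega_{\mathfrak g}$-linear $h$, and $[f]$ denotes the homotopy class. $V$ is a resolution of $G$ if $V^i=0$ for $i<0$,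 $G\cong\ker d^V_0$ and $\mathbf H^i(V)=0$ for $i\geq 1$. A Loday–Pirashvili module $(G,X)$ is a $\mathfrak g$-module $G$ with a $\mathfrak g$-equivariant linear map $X\colon G\to\mathfrak g$ (adjoint action on $\mathfrak g$); a morphism $(G,X)\to(H,Y)$ is a $\mathfrak g$-module map $\varphi$ with $Y\circ\varphi=X$. A dg Loday–Pirashvili module $(V,\alpha)$ is a non-negative bounded dg $\mathfrak g$-module $V$ with a weak morphism $\alpha\colon V\rightsquigarrow\mathfrak g$ ($\mathfrak g$ concentrated in degree $0$); a dg Loday–Pirashvili class is $(V,[\alpha])$. A morphism of classes $[f]\colon(V,[\alpha])\rightsquigarrow(W,[\beta])$ is the homotopy class of a weak morphism $f\colon V\rightsquigarrow W$ with $\beta\circ f$ homotopic to $\alpha$. $\mathbf H^0$ sends $(V,[\alpha])$ to $(\ker d^V_0,\alpha_0|_{\ker d^V_0})$ and $[f]$ to $\mathbf H^0(f)=f_0^0|_{\ker d^V_0}$. $(V,[\alpha])$ is a dg lift of $(G,X)$ if $\mathbf H^0(V,[\alpha])\cong(G,X)$ as Loday–Pirashvili modules. A dg lift of $\varphi$ is a morphism $[f]$ such that $\mathbf H^0(f)$ corresponds to $\varphi$ under these isomorphisms. *)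

(* Defs.v *)
From HB Require Import structures.
From mathcomp Require Import all_boot all_order all_algebra all_fingroup.
Set Implicit Arguments. Unset Strict Implicit. Unset Printing Implicit Defensive.
Import Order.TTheory GRing.Theory.
Local Open Scope ring_scope.

Record lie_algebra (K : fieldType) := LieAlgebra {
  lie_car :> vectType K;
  lie_br : lie_car -> lie_car -> lie_car;
  lie_brDl : forall a x y z, lie_br (a *: x + y) z = a *: lie_br x z + lie_br y z;
  lie_brDr : forall a x y z, lie_br z (a *: x + y) = a *: lie_br z x + lie_br z y;
  lie_br_alt : forall x, lie_br x x = 0;
  lie_jacobi : forall x y z,
    lie_br x (lie_br y z) + lie_br y (lie_br z x) + lie_br z (lie_br x y) = 0
}.

Arguments lie_br {K} l _ _.
Arguments lie_brDl {K} l _ _ _ _.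
Arguments lie_brDr {K} l _ _ _ _.
Arguments lie_br_alt {K} l _.
Arguments lie_jacobi {K} l _ _ _.

Section Defs.
Variable K : fieldType.
Variable g : lie_algebra K.
Local Notation br := (lie_br g).

Record gmodule := GModule {
  gm_car :> lmodType K;
  gm_act : g -> gm_car -> gm_car;
  gm_actDl : forall a x y v, gm_act (a *: x + y) v = a *: gm_act x v + gm_act y v;
  gm_actDr : forall a x v w, gm_act x (a *: v + w) = a *: gm_act x v + gm_act x w;
  gm_act_br : forall x y v,
    gm_act (br x y) v = gm_act x (gm_act y v) - gm_act y (gm_act x v)
}.

Record LPmodule := LPModule {
  LP_mod :> gmodule;
  LP_X : LP_mod -> g;
  LP_X_lin : forall a v w, LP_X (a *: v + w) = a *: LP_X v + LP_X w;
  LP_X_equiv : forall x v, LP_X (gm_act x v) = br x (LP_X v)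
}.

Definition LP_morphism (G H : LPmodule) (phi : G -> H) : Prop :=
  [/\ (forall a v w, phi (a *: v + w) = a *: phi v + phi w),
      (forall x v, phi (gm_act x v) = gm_act x (phi v)) &
      (forall v, @LP_X H (phi v) = @LP_X G v)].

Record dgmodule := DGModule {
  dg_obj : nat -> lmodType K;
  dg_act : forall n, g -> dg_obj n -> dg_obj n;
  dg_d : forall n, dg_obj n -> dg_obj n.+1;
  dg_actDl : forall n a x y (v : dg_obj n),
    dg_act (a *: x + y) v = a *: dg_act x v + dg_act y v;
  dg_actDr : forall n a x (v w : dg_obj n),
    dg_act x (a *: v + w) = a *: dg_act x v + dg_act x w;
  dg_act_br : forall n x y (v : dg_obj n),
    dg_act (br x y) v = dg_act x (dg_act y v) - dg_act y (dg_act x v);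
  dg_d_lin : forall n a (v w : dg_obj n), dg_d (a *: v + w) = a *: dg_d v + dg_d w;
  dg_d_equiv : forall n x (v : dg_obj n), dg_d (dg_act x v) = dg_act x (dg_d v);
  dg_dd : forall n (v : dg_obj n), dg_d (dg_d v) = 0;
  dg_bounded : exists N, forall n (v : dg_obj n), (N < n)%N -> v = 0
}.

Definition adj_obj (n : nat) : lmodType K :=
  match n with 0 => (g : lmodType K) | _.+1 => ('rV[K]_0 : lmodType K) end.

Definition adj_act (n : nat) (x : g) : adj_obj n -> adj_obj n :=
  match n as n0 return adj_obj n0 -> adj_obj n0 with
  | 0 => fun v => br x v
  | _.+1 => fun _ => 0
  end.

Definition adj_d (n : nat) (v : adj_obj n) : adj_obj n.+1 := 0.

Lemma br0l (z : g) : br 0 z = 0.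
Proof.
have := lie_brDl g 1 0 0 z; rewrite !scale1r addr0 => /eqP.
by rewrite -subr_eq0 opprD addrA subrr add0r oppr_eq0 => /eqP.
Qed.

Lemma br_addl (x y z : g) : br (x + y) z = br x z + br y z.
Proof. by have := lie_brDl g 1 x y z; rewrite !scale1r. Qed.

Lemma br_addr (x y z : g) : br z (x + y) = br z x + br z y.
Proof. by have := lie_brDr g 1 x y z; rewrite !scale1r. Qed.

Lemma br_anti (x y : g) : br x y = - br y x.
Proof.
apply/eqP; rewrite -subr_eq0 opprK; apply/eqP.
have := lie_br_alt g (x + y).
by rewrite br_addl !br_addr !lie_br_alt add0r addr0 addrC.
Qed.

Lemma br_oppr (x y : g) : br x (- y) = - br x y.
Proof.
apply/eqP; rewrite -subr_eq0 opprK -br_addr addNr.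
by rewrite br_anti br0l oppr0.
Qed.

Lemma adj_actDl n a x y (v : adj_obj n) :
  adj_act (a *: x + y) v = a *: adj_act x v + adj_act y v.
Proof. by case: n v => [|n] v /=; [exact: lie_brDl | rewrite scaler0 addr0]. Qed.

Lemma adj_actDr n a x (v w : adj_obj n) :
  adj_act x (a *: v + w) = a *: adj_act x v + adj_act x w.
Proof. by case: n v w => [|n] v w /=; [exact: lie_brDr | rewrite scaler0 addr0]. Qed.

Lemma adj_act_br n x y (v : adj_obj n) :
  adj_act (br x y) v = adj_act x (adj_act y v) - adj_act y (adj_act x v).
Proof.
case: n v => [|n] v /=; last by rewrite subr0.
have J := lie_jacobi g x y v.
rewrite [br v (br x y)]br_anti [br v x]br_anti br_oppr in J.
apply/eqP; rewrite eq_sym -subr_eq0 -J; apply/eqP.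
by rewrite addrC addrA.
Qed.
Lemma adj_d_lin n a (v w : adj_obj n) : adj_d (a *: v + w) = a *: adj_d v + adj_d w.
Proof. by rewrite /adj_d scaler0 addr0. Qed.

Lemma adj_d_equiv n x (v : adj_obj n) : adj_d (adj_act x v) = adj_act x (adj_d v).
Proof. by []. Qed.

Lemma adj_dd n (v : adj_obj n) : adj_d (adj_d v) = 0.
Proof. by []. Qed.

Lemma adj_bounded : exists N, forall n (v : adj_obj n), (N < n)%N -> v = 0.
Proof. by exists 0%N; case=> [|n] v //= _; apply: thinmx0. Qed.

Definition adj_dg : dgmodule :=
  DGModule adj_actDl adj_actDr adj_act_br adj_d_lin adj_d_equiv adj_dd adj_bounded.

(* Chevalley--Eilenberg complex Omega_g(V) = wedge g^v (x) V.               *)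
(* Since g is finite dimensional, wedge^p g^v (x) V^q is identified with the *)
(* space of alternating p-multilinear maps g^p -> V^q.  An element of       *)
(* Omega_g(V) is a family of such maps indexed by (p, q) (only finitely     *)
(* many are non-zero since p <= dim g and V is bounded); the total degree   *)
(* of the (p,q)-component is p + q.                                         *)
Definition tup (p : nat) := {ffun 'I_p -> g}.

Definition upd p (u : tup p) (i : 'I_p) (x : g) : tup p :=
  [ffun j => if j == i then x else u j].

Definition multilinear p (M : lmodType K) (phi : tup p -> M) : Prop :=
  forall (u : tup p) i a x y,
    phi (upd u i (a *: x + y)) = a *: phi (upd u i x) + phi (upd u i y).

Definition alternating p (M : lmodType K) (phi : tup p -> M) : Prop :=
  forall (u : tup p) (i j : 'I_p), i != j -> u i = u j -> phi u = 0.

Definition altmap p (M : lmodType K) (phi : tup p -> M) : Prop :=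
  multilinear phi /\ alternating phi.

Definition cochain (V : dgmodule) := forall p q : nat, tup p -> dg_obj V q.

Definition valid (V : dgmodule) (om : cochain V) : Prop :=
  forall p q, altmap (om p q).

Definition homog (V : dgmodule) (n : int) (om : cochain V) : Prop :=
  forall p q u, (p + q)%:Z != n -> om p q u = 0.

Definition ceq (V : dgmodule) (om1 om2 : cochain V) : Prop :=
  forall p q u, om1 p q u = om2 p q u.

Definition addc (V : dgmodule) (om1 om2 : cochain V) : cochain V :=
  fun p q u => om1 p q u + om2 p q u.

Definition oppc (V : dgmodule) (om : cochain V) : cochain V :=
  fun p q u => - om p q u.

Definition scalec (V : dgmodule) (a : K) (om : cochain V) : cochain V :=
  fun p q u => a *: om p q u.

Definition args p (u : tup p) : seq g := [seq u i | i <- enum 'I_p].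

Definition wedge (V : dgmodule) r (theta : tup r -> K^o) (om : cochain V) : cochain V :=
  fun p q u =>
    if (r <= p)%N then
      ((r`! * (p - r)`!)%:R^-1 : K) *:
        \sum_(s : 'S_p)
          (((-1) ^+ s * theta [ffun i : 'I_r => nth 0 (args [ffun k => u (s k)]) i]) *:
             om (p - r)%N q [ffun j : 'I_(p - r) => nth 0 (args [ffun k => u (s k)]) (r + j)])
    else 0.

Definition dCE (V : dgmodule) (om : cochain V) : cochain V :=
  fun p q =>
    match p return tup p -> dg_obj V q with
    | 0 => fun _ => 0
    | m.+1 => fun u =>
        \sum_(i < m.+1)
           (-1) ^+ i *: dg_act (u i)
              (om m q [ffun k : 'I_m => nth 0 [seq u l | l <- enum 'I_m.+1 & l != i] k])
      + \sum_(i < m.+1) \sum_(j < m.+1 | (i < j)%N)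
           (-1) ^+ (i + j) *:
              om m q [ffun k : 'I_m =>
                 nth 0 (br (u i) (u j) :: [seq u l | l <- enum 'I_m.+1 & (l != i) && (l != j)]) k]
    end.

Definition dint (V : dgmodule) (om : cochain V) : cochain V :=
  fun p q =>
    match q return tup p -> dg_obj V q with
    | 0 => fun _ => 0
    | q'.+1 => fun u => (-1) ^+ p *: dg_d (om p q' u)
    end.

Definition dtot (V : dgmodule) (om : cochain V) : cochain V :=
  addc (dCE om) (dint om).

(* Omega_g-linear maps of degree k (Koszul sign convention:
   F(theta /\ om) = (-1)^(k |theta|) theta /\ F(om)). *)
Definition omega_linear (V W : dgmodule) (k : int) (F : cochain V -> cochain W) : Prop :=
  [/\ (forall om, valid om -> valid (F om)),
      (forall om1 om2, valid om1 -> valid om2 ->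
         ceq (F (addc om1 om2)) (addc (F om1) (F om2))),
      (forall a om, valid om -> ceq (F (scalec a om)) (scalec a (F om))),
      (forall n om, valid om -> homog n om -> homog (n + k) (F om)) &
      (forall r (theta : tup r -> K^o) om, altmap theta -> valid om ->
         ceq (F (wedge theta om))
             (scalec ((-1) ^+ (r * odd `|k|%N)) (wedge theta (F om))))].

Definition weak_morphism (V W : dgmodule) (f : cochain V -> cochain W) : Prop :=
  omega_linear 0 f /\ (forall om, valid om -> ceq (f (dtot om)) (dtot (f om))).

Definition homotopic (V W : dgmodule) (f f' : cochain V -> cochain W) : Prop :=
  exists h : cochain V -> cochain W, omega_linear (-1) h /\
    (forall om, valid om ->
       ceq (addc (f' om) (oppc (f om))) (addc (dtot (h om)) (h (dtot om)))).

Definition incl0 (V : dgmodule) (v : dg_obj V 0) : cochain V :=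
  fun p q =>
    match q return tup p -> dg_obj V q with
    | 0 => fun _ => if p == 0%N then v else 0
    | _.+1 => fun _ => 0
    end.

Definition f00 (V W : dgmodule) (f : cochain V -> cochain W) (v : dg_obj V 0) : dg_obj W 0 :=
  f (incl0 v) 0%N 0%N [ffun i : 'I_0 => 0].

(* (V, [alpha]) is a dg lift of (G, X) via psi : the map psi : G -> V^0 is a
   g-equivariant linear isomorphism of G onto ker d_0, and under it
   alpha_0^0 restricted to ker d_0 corresponds to X, i.e.
   psi is an isomorphism of Loday--Pirashvili modules
   (G, X) ~= H^0(V,[alpha]) = (ker d_0, alpha_0^0|ker d_0). *)
Definition dg_lift_via (V : dgmodule) (alpha : cochain V -> cochain adj_dg)
    (G : LPmodule) (psi : G -> dg_obj V 0) : Prop :=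
  [/\ (forall a x y, psi (a *: x + y) = a *: psi x + psi y),
      (forall x y, psi (gm_act x y) = dg_act x (psi y)),
      injective psi,
      (forall v : dg_obj V 0, dg_d v = 0 <-> exists x, psi x = v) &
      (forall x, f00 alpha (psi x) = @LP_X G x)].

(* H^i(V) = 0 for i >= 1 (together with G ~= ker d_0 and V^i = 0 for i < 0,
   this makes V a resolution of G) *)
Definition acyclic_pos (V : dgmodule) : Prop :=
  forall i (v : dg_obj V i.+1), dg_d v = 0 -> exists w : dg_obj V i, dg_d w = v.

End Defs.

(* Main.v *)
Require Import Defs.
From HB Require Import structures.
From mathcomp Require Import all_boot all_order all_algebra all_fingroup.
From mathcomp Require Import boolp classical_sets.
Set Implicit Arguments. Unset Strict Implicit. Unset Printing Implicit Defensive.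
Import GRing.Theory.
Local Open Scope ring_scope.

(* Over a field the acyclic complex V has a linear contraction s, with
   d s + s d = 1 in positive degrees; s need not be equivariant. Extend it to
   Omega_g(V) by h (w (x) v) = (-1)^p w (x) s v and put
   E := 1 - (d_tot h + h d_tot). In d_CE h + h d_CE the bracket terms cancel, so
   E is linear over the forms although d_CE is only a derivation. E is homotopic
   to the identity, lowers the degree of V by one in positive degrees and projects
   V^0 onto ker d_0; as V is bounded, a power E^n maps Omega_g(V) to
   Omega_g(ker d_0), on which E is the identity.
   Existence: compose E^n with the equivariant map ker d_0 ~ G -> H ~ ker d_0.
   Uniqueness: the difference e of two weak morphisms that agree on ker d_0
   vanishes on Omega_g(ker d_0), so if 1 - E^n = d_tot h_n + h_n d_tot then
   e = d_tot (e h_n) + (e h_n) d_tot. The same argument, with target g, makes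
   beta o f homotopic to alpha.
   The identities of the Chevalley-Eilenberg calculus are proved by contracting
   with x in g (Cartan's formula) and inducting on the form degree. *)

(** * Linear sections and contractions *)

Section LinearChoice.
Variable K : fieldType.

Definition lin (U W : lmodType K) (t : U -> W) : Prop :=
  forall a x y, t (a *: x + y) = a *: t x + t y.

Section LinTheory.
Variables (U W : lmodType K) (t : U -> W).
Hypothesis tl : lin t.

Lemma linD x y : t (x + y) = t x + t y.
Proof. by have := tl 1 x y; rewrite !scale1r. Qed.

Lemma lin0 : t 0 = 0.
Proof. by apply: (addIr (t 0)); rewrite -linD !add0r. Qed.

Lemma linZ a x : t (a *: x) = a *: t x.
Proof. by have := tl a x 0; rewrite lin0 !addr0. Qed.

Lemma linN x : t (- x) = - t x.
Proof. by rewrite -scaleN1r linZ scaleN1r. Qed.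

Lemma linB x y : t (x - y) = t x - t y.
Proof. by rewrite linD linN. Qed.

Lemma lin_sum (I : Type) (r : seq I) (P : pred I) (F : I -> U) :
  t (\sum_(i <- r | P i) F i) = \sum_(i <- r | P i) t (F i).
Proof. exact: (big_morph t linD lin0). Qed.

End LinTheory.

Definition subspace (U : lmodType K) (S : U -> Prop) : Prop :=
  S 0 /\ forall a x y, S x -> S y -> S (a *: x + y).

Lemma subspaceB (U : lmodType K) (S : U -> Prop) x y :
  subspace S -> S x -> S y -> S (x - y).
Proof. by case=> _ SD Sx Sy; rewrite addrC -scaleN1r; apply: SD. Qed.

Lemma subspaceZ (U : lmodType K) (S : U -> Prop) a x :
  subspace S -> S x -> S (a *: x).
Proof. by case=> S0 SD Sx; rewrite -[_ *: _]addr0; apply: SD. Qed.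

(** Zorn's lemma gives a maximal [C] that is closed under linear combinations and meets [S] only in
    0. No dimension is assumed, since the terms of a dg module may be infinite-dimensional. *)
Lemma exists_complement (U : lmodType K) (S : U -> Prop) : subspace S ->
  exists C : U -> Prop, [/\ subspace C, forall v, C v -> S v -> v = 0
    & forall v, exists c t, [/\ C c, S t & v = c + t]].
Proof.
move=> sS.
(* [P] does not require $0 \in C$: the union of the empty chain is empty and must satisfy [P]. The
   zero vector is restored in [C0]. *)
pose P (C : set U) := (forall a x y, C x -> C y -> C (a *: x + y)) /\
   forall v, C v -> S v -> v = 0.
have [F FP tF|C [[CD CS] Cmax]] := @Zorn_bigcup U P.
  split=> [a x y [X FX Xx] [Y FY Yy]|v [X FX Xv]]; last exact: (FP _ FX).2.
  case: (tF _ _ FX FY) => sub.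
    by exists Y => //; apply: (FP _ FY).1 => //; apply: sub.
  by exists X => //; apply: (FP _ FX).1 => //; apply: sub.
pose C0 v := C v \/ v = 0.
have sC0 : subspace C0.
  split=> [|a x y]; first by right.
  case=> [Cx|->]; case=> [Cy|->]; rewrite ?scaler0 ?addr0 ?add0r.
  - by left; apply: CD.
  - have C00 : C 0 by have := CD (-1) x x Cx Cx; rewrite scaleN1r addNr.
    by left; rewrite -[_ *: _]addr0; apply: CD.
  - by left.
  - by right.
have C0S v : C0 v -> S v -> v = 0 by case=> // Cv; apply: CS.
exists C0; split=> // v0.
apply: contrapT => nv0.
(* [C'] is $C_0 + \mathbb K v_0$, strictly larger than [C]. If it met [S] in $c + a v_0$ with $a
   \neq 0$, then [v0] would split along [C0] and [S], against [nv0]. *)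
pose C' : set U := fun v => exists a c, C0 c /\ v = c + a *: v0.
apply: (Cmax C'); last first.
  split.
    move=> a _ _ [b [c [cC ->]]] [b' [c' [cC' ->]]].
    exists (a * b + b'), (a *: c + c'); split; first exact: sC0.2.
    by rewrite scalerDr scalerDl scalerA addrACA.
  move=> _ [a [c [Cc ->]]] Sv.
  have [a0|an0] := eqVneq a 0.
    by move: Sv; rewrite a0 scale0r addr0; apply: C0S.
  case: nv0; exists (- a^-1 *: c), (a^-1 *: (c + a *: v0)); split.
  - exact: subspaceZ.
  - exact: subspaceZ.
  - by rewrite scalerDr scalerA mulVf // scale1r addrA -scalerDl addNr scale0r add0r.
split; first by move=> c Cc; exists 0, c; split; [left|rewrite scale0r addr0].
move=> sub; apply: nv0; exists v0, 0; split; last by rewrite addr0.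
  by left; apply: sub; exists 1, 0; split; [right|rewrite add0r scale1r].
exact: sS.1.
Qed.

Lemma exists_projection (U : lmodType K) (S : U -> Prop) : subspace S ->
  exists p : U -> U, [/\ lin p, forall x, S (p x) & forall x, S x -> p x = x].
Proof.
move=> sS; have [C [sC CS CSv]] := exists_complement sS.
have /choice[p pP] : forall v, exists t, S t /\ C (v - t).
  by move=> v; have [c [t [Cc St ->]]] := CSv v; exists t; rewrite addrK.
have p_uniq v t : S t -> C (v - t) -> p v = t.
  move=> St Ct; have [Sp Cp] := pP v.
  apply/eqP; rewrite -subr_eq0; apply/eqP; apply: CS; last exact: subspaceB.
  have -> : p v - t = (v - t) - (v - p v).
    by rewrite opprB [RHS]addrC addrA subrK.
  exact: subspaceB.
exists p; split=> [a x y|x|x Sx].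
- have [[Sx Cx] [Sy Cy]] := (pP x, pP y).
  apply: p_uniq; first exact: sS.2.
  have -> : a *: x + y - (a *: p x + p y) = a *: (x - p x) + (y - p y).
    by rewrite scalerBr opprD addrACA.
  exact: sC.2.
- exact: (pP x).1.
- by apply: p_uniq => //; rewrite subrr; apply: sC.1.
Qed.

(** Preimages [r] are chosen arbitrarily on the image of [t]. Subtracting their component in the
    kernel, given by the projection [q], leaves a vector that depends only on its image under [t];
    hence the choice becomes linear. *)
Lemma exists_generalized_inverse (U W : lmodType K) (t : U -> W) : lin t ->
  exists s : W -> U, lin s /\ forall u, t (s (t u)) = t u.
Proof.
move=> tl.
have [|q [ql tq qker]] := @exists_projection U (fun u => t u = 0).
  split=> [|a x y tx ty]; first exact: lin0.
  by rewrite tl tx ty scaler0 addr0.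
have [|p [pl pim pid]] := @exists_projection W (fun w => exists u, t u = w).
  split=> [|a _ _ [x <-] [y <-]]; first by exists 0; apply: lin0.
  by exists (a *: x + y); apply: tl.
have [r rP] := choice pim.
have qP u u' : t u = t u' -> u - q u = u' - q u'.
  move=> tu; have := qker (u - u'); rewrite linB // tu subrr => /(_ erefl).
  rewrite linB // => e.
  by apply/eqP; rewrite subr_eq -addrA [- _ + _]addrC e addrC subrK.
exists (fun w => r w - q (r w)); split=> [a x y|u]; last first.
  by rewrite linB // tq subr0 rP pid //; exists u.
transitivity ((a *: r x + r y) - q (a *: r x + r y)).
  by apply: qP; rewrite tl !rP pl.
by rewrite ql opprD addrACA scalerBr.
Qed.

End LinearChoice.

Section Contraction.
Variables (K : fieldType) (g : lie_algebra K) (V : dgmodule g).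

Definition is_contraction (s : forall q, dg_obj V q.+1 -> dg_obj V q) : Prop :=
  (forall q, lin (s q)) /\
  forall q (v : dg_obj V q.+1), dg_d (s q v) + s q.+1 (dg_d v) = v.

(** With generalized inverses $\sigma$ of $d$, put $s = \sigma(1 - \sigma d)$. The vector $v -
    \sigma d v$ is closed, hence exact, so $d\sigma$ fixes it and $d s v = v - \sigma d v$; and $s d
    v = \sigma d v$ because $d d = 0$. *)
Lemma exists_contraction : acyclic_pos V -> exists s, is_contraction s.
Proof.
move=> acV.
have dl n : lin (@dg_d K g V n) by move=> a x y; apply: dg_d_lin.
pose sig n := proj1_sig (cid (exists_generalized_inverse (dl n))).
have sigP n : lin (sig n) /\ forall u, dg_d (sig n (dg_d u)) = dg_d u.
  by rewrite /sig; case: cid.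
exists (fun q v => sig q (v - sig q.+1 (dg_d v))); split=> [q a x y|q v].
  have [sl _] := sigP q; have [sl1 _] := sigP q.+1.
  by rewrite dl sl1 -sl; congr sig; rewrite opprD addrACA scalerBr.
have [sl sd] := sigP q; have [sl1 sd1] := sigP q.+1.
rewrite dg_dd (lin0 (sigP q.+2).1) subr0.
have [|w dw] := acV q (v - sig q.+1 (dg_d v)).
  by rewrite (linB (dl _)) sd1 subrr.
by rewrite -dw sd dw subrK.
Qed.

End Contraction.

(** * Alternating maps and contraction by a vector *)

Section Tuples.
Variables (K : fieldType) (g : lie_algebra K).

(** Argument lists are read exactly as in [dCE], with default 0, so that omitting or inserting an
    entry is a list operation and needs no transport between arities. *)
Definition tmk p (l : seq g) : tup g p := [ffun k : 'I_p => nth 0 l k].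

Definition tcons p (x : g) (u : tup g p) : tup g p.+1 :=
  [ffun k => oapp u x (unlift ord0 k)].

Definition omit m (u : tup g m) (i : 'I_m) : seq g :=
  [seq u l | l <- enum 'I_m & l != i].

Definition omit2 m (u : tup g m) (i j : 'I_m) : seq g :=
  [seq u l | l <- enum 'I_m & (l != i) && (l != j)].

Lemma tcons0 p x (u : tup g p) : tcons x u ord0 = x.
Proof. by rewrite ffunE unlift_none. Qed.

Lemma tconsS p x (u : tup g p) i : tcons x u (lift ord0 i) = u i.
Proof. by rewrite ffunE liftK. Qed.

Lemma tup0_eq (u v : tup g 0) : u = v.
Proof. by apply/ffunP; case. Qed.

Lemma tupS_eq p (u : tup g p.+1) :
  u = tcons (u ord0) [ffun i => u (lift ord0 i)].
Proof.
apply/ffunP=> i; case: (unliftP ord0 i) => [j|] ->; last by rewrite tcons0.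
by rewrite tconsS ffunE.
Qed.

Lemma tmk_cons p x l : tmk p.+1 (x :: l) = tcons x (tmk p l).
Proof.
apply/ffunP=> i; case: (unliftP ord0 i) => [j|] ->; last by rewrite tcons0 ffunE.
by rewrite tconsS !ffunE lift0.
Qed.

Lemma size_args p (u : tup g p) : size (args u) = p.
Proof. by rewrite size_map size_enum_ord. Qed.

Lemma nth_args p (u : tup g p) (i : 'I_p) : nth 0 (args u) i = u i.
Proof. by rewrite (nth_map i) ?size_enum_ord // nth_ord_enum. Qed.

Lemma tmk_args p (u : tup g p) : tmk p (args u) = u.
Proof. by apply/ffunP=> i; rewrite ffunE nth_args. Qed.

Lemma omit_tcons0 m x (u : tup g m) : omit (tcons x u) ord0 = args u.
Proof.
rewrite /omit enum_ordSl /= filter_map -map_comp.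
rewrite (eq_filter (a2 := predT)) ?filter_predT //.
by apply: eq_map => i /=; rewrite tconsS.
Qed.

Lemma omit_tconsS m x (u : tup g m) i :
  omit (tcons x u) (lift ord0 i) = x :: omit u i.
Proof.
rewrite /omit enum_ordSl /= tcons0 filter_map -map_comp; congr cons.
rewrite (eq_filter (a2 := fun l => l != i)).
  by apply: eq_map => l /=; rewrite tconsS.
by move=> l /=; rewrite (inj_eq lift_inj).
Qed.

Lemma omit2_tcons0 m x (u : tup g m) j :
  omit2 (tcons x u) ord0 (lift ord0 j) = omit u j.
Proof.
rewrite /omit2 enum_ordSl /= filter_map -map_comp.
rewrite (eq_filter (a2 := fun l => l != j)).
  by apply: eq_map => l /=; rewrite tconsS.
by move=> l /=; rewrite (inj_eq lift_inj).
Qed.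

Lemma omit2_tconsS m x (u : tup g m) i j :
  omit2 (tcons x u) (lift ord0 i) (lift ord0 j) = x :: omit2 u i j.
Proof.
rewrite /omit2 enum_ordSl /= tcons0 filter_map -map_comp; congr cons.
rewrite (eq_filter (a2 := fun l => (l != i) && (l != j))).
  by apply: eq_map => l /=; rewrite tconsS.
by move=> l /=; rewrite !(inj_eq lift_inj).
Qed.

Lemma upd_tconsS p x (u : tup g p) i y :
  upd (tcons x u) (lift ord0 i) y = tcons x (upd u i y).
Proof.
apply/ffunP=> j; rewrite ffunE; case: (unliftP ord0 j) => [k|] ->.
  by rewrite (inj_eq lift_inj) !tconsS ffunE.
by rewrite tcons0 (negbTE (neq_lift _ _)) tcons0.
Qed.

Lemma upd_tcons0 p x (u : tup g p) y : upd (tcons x u) ord0 y = tcons y u.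
Proof.
apply/ffunP=> j; rewrite ffunE; case: (unliftP ord0 j) => [k|] ->.
  by rewrite eq_sym (negbTE (neq_lift _ _)) !tconsS.
by rewrite eqxx tcons0.
Qed.

Section Alternating.
Variable M : lmodType K.
Implicit Type p : nat.

Lemma altmap_tcons p (phi : tup g p.+1 -> M) x :
  altmap phi -> altmap (fun u => phi (tcons x u)).
Proof.
case=> mphi aphi; split=> [u i a y z|u i j neq_ij eq_u].
  by rewrite -!upd_tconsS mphi.
apply: (aphi _ (lift ord0 i) (lift ord0 j)); last by rewrite !tconsS.
by rewrite (inj_eq lift_inj).
Qed.

Lemma altmap_lin p (phi : tup g p.+1 -> M) u :
  altmap phi -> lin (fun x : g => phi (tcons x u)).
Proof. by case=> mphi _ a x y; have := mphi (tcons 0 u) ord0 a x y; rewrite !upd_tcons0. Qed.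

Lemma altmap_diag p (phi : tup g p.+2 -> M) x u :
  altmap phi -> phi (tcons x (tcons x u)) = 0.
Proof.
by case=> _ aphi; apply: (aphi _ ord0 (lift ord0 ord0)); rewrite // tconsS !tcons0.
Qed.

Lemma altmap_swap p (phi : tup g p.+2 -> M) x y u : altmap phi ->
  phi (tcons x (tcons y u)) = - phi (tcons y (tcons x u)).
Proof.
move=> aphi; have := altmap_diag (x + y) u aphi.
rewrite (linD (altmap_lin _ aphi)) !(linD (altmap_lin _ (altmap_tcons _ aphi))).
rewrite !altmap_diag // addr0 add0r => /eqP.
by rewrite addr_eq0 => /eqP.
Qed.

Lemma altmap0 (phi : tup g 0 -> M) : altmap phi.
Proof. by split=> u []. Qed.

Lemma altmapS p (phi : tup g p.+1 -> M) :
  (forall u, lin (fun x : g => phi (tcons x u))) ->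
  (forall x, altmap (fun u => phi (tcons x u))) ->
  (forall x (u : tup g p), (exists i, u i = x) -> phi (tcons x u) = 0) ->
  altmap phi.
Proof.
move=> phi_lin phi_alt phi_diag; split=> [u i a x y|u i j].
  rewrite (tupS_eq u); case: (unliftP ord0 i) => [k|] ->.
    by rewrite !upd_tconsS; apply: (phi_alt _).1.
  by rewrite !upd_tcons0; apply: phi_lin.
rewrite (tupS_eq u).
case: (unliftP ord0 i) (unliftP ord0 j) => [i'|] -> [j'|] ->; rewrite ?tconsS ?tcons0 //.
- by rewrite (inj_eq lift_inj) => neq_ij eq_u; apply: (phi_alt _).2 neq_ij eq_u.
- by move=> _ eq_u; apply: phi_diag; exists i'.
- by move=> _ eq_u; apply: phi_diag; exists j'.
Qed.

(** Polarizing the diagonal condition exchanges the first two entries up to sign. A first entry that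
    is repeated further on thereby moves behind [y], where the inner map is already alternating. *)
Lemma altmapSS p (phi : tup g p.+2 -> M) :
  (forall u, lin (fun x : g => phi (tcons x u))) ->
  (forall x, altmap (fun u => phi (tcons x u))) ->
  (forall x u, phi (tcons x (tcons x u)) = 0) ->
  altmap phi.
Proof.
move=> phi_lin phi_alt phi_diag; apply: altmapS => // x u [i].
rewrite (tupS_eq u); set y := u ord0; set u' := [ffun _ => _].
case: (unliftP ord0 i) => [k|] ->; last by rewrite tcons0 => ->; apply: phi_diag.
rewrite tconsS => uk.
have : phi (tcons (x + y) (tcons (x + y) u')) = 0 by apply: phi_diag.
rewrite (linD (phi_lin _)) !(linD (altmap_lin _ (phi_alt _))).
rewrite !phi_diag add0r addr0 => /eqP; rewrite addr_eq0 => /eqP ->.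
by rewrite (proj2 (phi_alt y) _ ord0 (lift ord0 k)) ?oppr0 ?neq_lift ?tcons0 ?tconsS.
Qed.

Lemma altmapD p (phi psi : tup g p -> M) :
  altmap phi -> altmap psi -> altmap (fun u => phi u + psi u).
Proof.
move=> [mphi aphi] [mpsi apsi]; split=> [u i a x y|u i j ne e].
  by rewrite mphi mpsi scalerDr addrACA.
by rewrite (aphi u i j) // (apsi u i j) // addr0.
Qed.

End Alternating.

Lemma altmap_map (M M' : lmodType K) (t : M -> M') p (phi : tup g p -> M) :
  lin t -> altmap phi -> altmap (fun u => t (phi u)).
Proof.
move=> tl [mphi aphi]; split=> [u i a x y|u i j ne e].
  by rewrite mphi tl.
by rewrite (aphi u i j) // lin0.
Qed.

End Tuples.

(** * Families of maps in all form degrees, and operators on them *)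

Definition fam (K : fieldType) (g : lie_algebra K) (M : lmodType K) :=
  forall p, tup g p -> M.

(* Locked, so that unification does not see a sum in every family. *)
HB.lock Definition fam_add (K : fieldType) (g : lie_algebra K) (M : lmodType K)
  (om1 om2 : fam g M) : fam g M := fun p u => om1 p u + om2 p u.
HB.lock Definition fam_opp (K : fieldType) (g : lie_algebra K) (M : lmodType K)
  (om : fam g M) : fam g M := fun p u => - om p u.
HB.lock Definition fam_zero (K : fieldType) (g : lie_algebra K) (M : lmodType K)
  : fam g M := fun p u => 0.
HB.lock Definition fam_scale (K : fieldType) (g : lie_algebra K) (M : lmodType K)
  (a : K) (om : fam g M) : fam g M := fun p u => a *: om p u.

Section Families.
Variables (K : fieldType) (g : lie_algebra K).
Local Notation fam M := (fam g M).

Section FamLmod.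
Variable M : lmodType K.
Local Notation fam_add := (@fam_add K g M).
Local Notation fam_opp := (@fam_opp K g M).
Local Notation fam_zero := (@fam_zero K g M).
Local Notation fam_scale := (@fam_scale K g M).

HB.instance Definition _ := gen_eqMixin (fam M).
HB.instance Definition _ := gen_choiceMixin (fam M).

Lemma famP (om1 om2 : fam M) : (forall p u, om1 p u = om2 p u) -> om1 = om2.
Proof. by move=> e; apply: functional_extensionality_dep => p; apply: funext => u. Qed.

Fact fam_addA : associative fam_add.
Proof. by move=> a b c; apply: famP => p u; rewrite !unlock addrA. Qed.
Fact fam_addC : commutative fam_add.
Proof. by move=> a b; apply: famP => p u; rewrite !unlock addrC. Qed.
Fact fam_add0 : left_id fam_zero fam_add.
Proof. by move=> a; apply: famP => p u; rewrite !unlock add0r. Qed.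
Fact fam_addN : left_inverse fam_zero fam_opp fam_add.
Proof. by move=> a; apply: famP => p u; rewrite !unlock addNr. Qed.

HB.instance Definition _ :=
  GRing.isZmodule.Build (fam M) fam_addA fam_addC fam_add0 fam_addN.

Lemma famDE (om1 om2 : fam M) p u : (om1 + om2) p u = om1 p u + om2 p u.
Proof. by rewrite -[LHS]/((fam_add om1 om2 : fam M) p u) unlock. Qed.

Fact fam_scaleA a b v : fam_scale a (fam_scale b v) = fam_scale (a * b) v.
Proof. by apply: famP => p u; rewrite !unlock scalerA. Qed.
Fact fam_scale1 : left_id 1 fam_scale.
Proof. by move=> a; apply: famP => p u; rewrite !unlock scale1r. Qed.
Fact fam_scaleDr : right_distributive fam_scale +%R.
Proof. by move=> a v w; apply: famP => p u; rewrite famDE !unlock famDE scalerDr. Qed.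
Fact fam_scaleDl v : {morph fam_scale^~ v : a b / a + b}.
Proof. by move=> a b; apply: famP => p u; rewrite famDE !unlock scalerDl. Qed.

HB.instance Definition _ := GRing.Zmodule_isLmodule.Build K (fam M)
  fam_scaleA fam_scale1 fam_scaleDr fam_scaleDl.

Lemma famNE (om : fam M) p u : (- om) p u = - om p u.
Proof. by rewrite -[LHS]/((fam_opp om : fam M) p u) unlock. Qed.
Lemma fam0E p u : (0 : fam M) p u = 0.
Proof. by rewrite -[LHS]/((fam_zero : fam M) p u) unlock. Qed.
Lemma famZE a (om : fam M) p u : (a *: om) p u = a *: om p u.
Proof. by rewrite -[LHS]/((fam_scale a om : fam M) p u) unlock. Qed.

Definition famE := (famDE, famNE, fam0E, famZE).

(** The interior product $\iota_x$. *)
Definition contr (x : g) (om : fam M) : fam M := fun p u => om p.+1 (tcons x u).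
Arguments contr x om p u : clear implicits.

Definition validf (om : fam M) : Prop := forall p, altmap (om p).

Lemma contr_is_lin x : lin (contr x).
Proof. by move=> a v w; apply: famP => p u; rewrite /contr !famE. Qed.

Lemma contr_lin om : validf om -> lin (fun x : g => contr x om : fam M).
Proof.
by move=> vom a x y; apply: famP => p u; rewrite !famE; apply: (altmap_lin u (vom _)).
Qed.

Lemma contr_diag om x : validf om -> contr x (contr x om) = 0.
Proof. by move=> vom; apply: famP => p u; rewrite famE; apply: altmap_diag. Qed.

Lemma contr_swap om x y : validf om ->
  contr x (contr y om) = - contr y (contr x om).
Proof. by move=> vom; apply: famP => p u; rewrite famE; apply: altmap_swap. Qed.

Lemma validf_contr x om : validf om -> validf (contr x om).
Proof. by move=> vom p; apply: altmap_tcons. Qed.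

Lemma validf_lin a om1 om2 : validf om1 -> validf om2 -> validf (a *: om1 + om2).
Proof.
move=> v1 v2 p.
have -> : (a *: om1 + om2) p = fun u => a *: om1 p u + om2 p u.
  by apply: funext => u; rewrite !famE.
apply: altmapD => //.
by apply: (altmap_map (t := fun v => a *: v)) => // b x y;
  rewrite scalerDr !scalerA mulrC.
Qed.

Lemma validfD om1 om2 : validf om1 -> validf om2 -> validf (om1 + om2).
Proof. by move=> v1 v2; rewrite -[om1]scale1r; apply: validf_lin. Qed.

Lemma validf0 : validf 0.
Proof. by move=> p; split=> [u i a x y|u i j _ _]; rewrite !famE ?scaler0 ?addr0. Qed.

Lemma validfZ a om : validf om -> validf (a *: om).
Proof. by move=> v; rewrite -[_ *: _]addr0; apply: validf_lin => //; apply: validf0. Qed.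

Lemma validfN om : validf om -> validf (- om).
Proof. by rewrite -scaleN1r; apply: validfZ. Qed.

Lemma validfB om1 om2 : validf om1 -> validf om2 -> validf (om1 - om2).
Proof. by move=> v1 v2; apply: validfD => //; apply: validfN. Qed.

Lemma validf_coind (Z : fam M -> Prop) :
  (forall om x, Z om -> Z (contr x om)) ->
  (forall om, Z om -> lin (fun x : g => contr x om : fam M)) ->
  (forall om x, Z om -> contr x (contr x om) = 0) ->
  forall om, Z om -> validf om.
Proof.
move=> Zc Zl Zd om Zom p; elim: p om Zom => [|p IH] om Zom; first exact: altmap0.
have ol u : lin (fun x : g => om p.+1 (tcons x u)).
  by move=> a x y; rewrite -[LHS]/(contr _ om p u) Zl // !famE.
have oa x : altmap (fun u => om p.+1 (tcons x u)).
  exact: (IH _ (Zc _ x Zom)).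
case: p => [|p] in IH ol oa *; first by apply: altmapS => // x u [[]].
apply: altmapSS => // x u; rewrite -[LHS]/(contr x (contr x om) p u).
by rewrite Zd // famE.
Qed.

(** The tool for identities between operators: [Z] is taken as all the differences of the two sides,
    and once it is stable under contraction only form degree 0 has to be checked. *)
Lemma fam0_coind (Z : fam M -> Prop) :
  (forall om x, Z om -> Z (contr x om)) -> (forall om u, Z om -> om 0%N u = 0) ->
  forall om, Z om -> om = 0.
Proof.
move=> Zc Z0 om Zom; apply: famP => p; elim: p om Zom => [|p IH] om Zom u.
  by rewrite famE; apply: Z0.
by rewrite (tupS_eq u) -[LHS]/(contr _ om p _) IH ?famE //; apply: Zc.
Qed.

End FamLmod.

Section Operators.
Variables M M' : lmodType K.

Definition mapf (t : M -> M') (om : fam M) : fam M' := fun p u => t (om p u).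
Arguments mapf t om p u : clear implicits.

(** The part of $d_{\mathrm{CE}}$ without brackets, for an arbitrary [eta] in place of the action.
    The target [M'] may differ from [M], as it does for the defect of equivariance of a contraction,
    which lowers the internal degree. *)
Definition actf (eta : g -> M -> M') (om : fam M) : fam M' := fun p =>
  match p return tup g p -> M' with
  | 0 => fun _ => 0
  | m.+1 => fun u =>
     \sum_(i < m.+1) (-1) ^+ i *: eta (u i) (om m (tmk m (omit u i)))
  end.
Arguments actf eta om p u : clear implicits.

Lemma mapf_lin t : lin t -> lin (mapf t).
Proof. by move=> tl a x y; apply: famP => p u; rewrite /mapf !famE tl. Qed.

Lemma contr_mapf t x om : contr x (mapf t om) = mapf t (contr x om).
Proof. by []. Qed.

Lemma validf_mapf t om : lin t -> validf om -> validf (mapf t om).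
Proof. by move=> tl vom p; apply: altmap_map. Qed.

Variable eta : g -> M -> M'.
Hypothesis eta_linr : forall x, lin (eta x).

Lemma actf_lin : lin (actf eta).
Proof.
move=> a x y; apply: famP => -[|m] u /=; first by rewrite !famE scaler0 addr0.
rewrite !famE scaler_sumr -big_split /=; apply: eq_bigr => i _.
by rewrite !famE eta_linr scalerDr !scalerA mulrC.
Qed.

Lemma contr_actf x om : contr x (actf eta om) = mapf (eta x) om - actf eta (contr x om).
Proof.
apply: famP => p u; rewrite !famE /contr /mapf /= big_ord_recl tcons0 omit_tcons0.
rewrite tmk_args expr0 scale1r; congr (_ + _).
case: p u => [|p] u; first by rewrite big_ord0 oppr0.
rewrite -sumrN; apply: eq_bigr => i _.
by rewrite tconsS omit_tconsS tmk_cons lift0 exprS mulN1r scaleNr.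
Qed.

Hypothesis eta_linl : forall v, lin (fun x : g => eta x v).

Lemma mapf_linl om : lin (fun x : g => mapf (eta x) om : fam M').
Proof. by move=> a x y; apply: famP => p u; rewrite !famE; apply: (eta_linl (om p u)). Qed.

Lemma validf_actf om : validf om -> validf (actf eta om).
Proof.
move=> vom.
(* Contracting [actf eta a] also produces the term [mapf (eta x) a]; the class is stable only with
   an arbitrary valid summand [b]. *)
apply: (@validf_coind _ (fun o => exists a b, [/\ validf a, validf b
    & o = actf eta a + b])) => [_ x [a [b [va vb ->]]]|_ [a [b [va vb ->]]]
   |_ x [a [b [va vb ->]]]|]; last first.
- by exists om, 0; split; rewrite ?addr0 //; apply: validf0.
- rewrite (linD (contr_is_lin x)) contr_actf !(linD (contr_is_lin x)).
  rewrite contr_diag // (linN (contr_is_lin x)) contr_actf contr_diag //.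
  by rewrite (lin0 actf_lin) subr0 contr_mapf addr0 subrr.
- move=> c x y; rewrite !(linD (contr_is_lin _)) !contr_actf.
  rewrite (contr_lin vb) (contr_lin va) actf_lin mapf_linl.
  by rewrite opprD !scalerDr scalerN [X in X + _ = _]addrACA [LHS]addrACA.
rewrite (linD (contr_is_lin x)) contr_actf -(linN actf_lin).
exists (- contr x a), (mapf (eta x) a + contr x b); split.
- by apply: validfN; apply: validf_contr.
- by apply: validfD; [apply: validf_mapf|apply: validf_contr].
- by rewrite addrCA addrA.
Qed.

End Operators.
End Families.

Arguments contr {K g M} x om p u.
Arguments mapf {K g M M'} t om p u.
Arguments actf {K g M M'} eta om p u.

(** * Cartan calculus for the Chevalley-Eilenberg differential *)

Section Cartan.
Variables (K : fieldType) (g : lie_algebra K).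
Local Notation br := (lie_br g).
Local Notation fam M := (fam g M).

Section Brackets.
Variable M : lmodType K.

Definition brf (om : fam M) : fam M := fun p =>
  match p return tup g p -> M with
  | 0 => fun _ => 0
  | m.+1 => fun u => \sum_(i < m.+1) \sum_(j < m.+1 | (i < j)%N)
      (-1) ^+ (i + j) *: om m (tmk m (br (u i) (u j) :: omit2 u i j))
  end.
Arguments brf om p u : clear implicits.

(** On alternating maps this is $\sum_j \omega(u_0, \dots, [x,u_j], \dots)$: the sign $(-1)^j$ pays
    for writing the bracket in first place. *)
Definition rotf (x : g) (om : fam M) : fam M := fun p =>
  match p return tup g p -> M with
  | 0 => fun _ => 0
  | m.+1 => fun u => \sum_(j < m.+1)
      (-1) ^+ j *: om m.+1 (tmk m.+1 (br x (u j) :: omit u j))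
  end.
Arguments rotf x om p u : clear implicits.

Lemma brf_lin : lin brf.
Proof.
move=> a v w; apply: famP => -[|m] u; rewrite !famE /= ?scaler0 ?addr0 //.
rewrite scaler_sumr -big_split /=; apply: eq_bigr => i _.
rewrite scaler_sumr -big_split /=; apply: eq_bigr => j _.
by rewrite !famE scalerDr !scalerA mulrC.
Qed.

Lemma rotf_lin x : lin (rotf x).
Proof.
move=> a v w; apply: famP => -[|m] u; rewrite !famE /= ?scaler0 ?addr0 //.
rewrite scaler_sumr -big_split /=; apply: eq_bigr => i _.
by rewrite !famE scalerDr !scalerA mulrC.
Qed.

Lemma rotf_linl om : validf om -> lin (fun x : g => rotf x om : fam M).
Proof.
move=> vom a x y; apply: famP => -[|m] u; rewrite !famE /= ?scaler0 ?addr0 //.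
rewrite scaler_sumr -big_split /=; apply: eq_bigr => i _.
rewrite lie_brDl !tmk_cons (altmap_lin _ (vom m.+1)).
by rewrite scalerDr !scalerA mulrC.
Qed.

Lemma contr_rotf x y om : validf om ->
  contr y (rotf x om) = contr (br x y) om + rotf x (contr y om).
Proof.
move=> vom; apply: famP => p u; rewrite famE /contr /= big_ord_recl.
rewrite tcons0 omit_tcons0 expr0 scale1r tmk_cons tmk_args; congr (_ + _).
case: p u => [|p] u /=; first by rewrite big_ord0.
apply: eq_bigr => j _; rewrite tconsS omit_tconsS /bump add1n !tmk_cons.
by rewrite altmap_swap // exprS mulN1r scaleNr scalerN opprK.
Qed.

(** Pairs of indices that contain 0 bracket [x] with an entry and give [- rotf x om]. In the other
    pairs [x] stands just behind the bracket, and one exchange of the two gives the minus sign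
    before [brf]. *)
Lemma contr_brf x om : validf om ->
  contr x (brf om) = - rotf x om - brf (contr x om).
Proof.
move=> vom; apply: famP => p u; rewrite !famE /contr /= big_ord_recl; congr (_ + _).
  rewrite big_mkcond big_ord_recl /= add0r.
  case: p u => [|p] u /=; first by rewrite big_ord0 oppr0.
  rewrite -sumrN; apply: eq_bigr => j _.
  by rewrite tcons0 tconsS omit2_tcons0 /bump add1n add0n exprS mulN1r scaleNr.
case: p u => [|p] u /=; first by rewrite big_ord0 oppr0.
rewrite -sumrN; apply: eq_bigr => i _.
rewrite -sumrN big_mkcond [RHS]big_mkcond big_ord_recl /= add0r.
apply: eq_bigr => j _; rewrite /bump !add1n ltnS.
case: ltnP => // ltij; rewrite !tconsS omit2_tconsS.
case: p u i j ltij => [|p] u i j ltij; first by move: ltij; rewrite !ord1.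
rewrite !tmk_cons altmap_swap // addnS addSn !exprS !mulN1r opprK.
by rewrite scalerN.
Qed.

End Brackets.
Arguments brf {M} om p u.
Arguments rotf {M} x om p u.

Variable M : gmodule g.
Local Notation act := (@gm_act K g M).

Lemma act_linr x : lin (act x).
Proof. by move=> a v w; apply: gm_actDr. Qed.

Lemma act_linl v : lin (fun x : g => act x v).
Proof. by move=> a x y; apply: gm_actDl. Qed.

Definition Lie (x : g) (om : fam M) : fam M :=
  fun p u => act x (om p u) - rotf x om p u.
Arguments Lie x om p u : clear implicits.

Definition ce (om : fam M) : fam M := fun p u => actf act om p u + brf om p u.
Arguments ce om p u : clear implicits.

Lemma LieE x om : Lie x om = mapf (act x) om - rotf x om.
Proof. by apply: famP => p u; rewrite !famE. Qed.

Lemma ceE om : ce om = actf act om + brf om.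
Proof. by apply: famP => p u; rewrite !famE. Qed.

Lemma Lie_lin x : lin (Lie x).
Proof.
move=> a v w; rewrite !LieE (mapf_lin (act_linr x)) rotf_lin.
by rewrite opprD addrACA scalerBr.
Qed.

Lemma Lie_linl om : validf om -> lin (fun x : g => Lie x om : fam M).
Proof.
move=> vom a x y; rewrite !LieE (mapf_linl act_linl) (rotf_linl vom).
by rewrite opprD addrACA scalerBr.
Qed.

Lemma ce_lin : lin ce.
Proof.
by move=> a v w; rewrite !ceE (actf_lin act_linr) brf_lin addrACA scalerDr.
Qed.

Lemma contr_Lie x y om : validf om ->
  contr y (Lie x om) = Lie x (contr y om) - contr (br x y) om.
Proof.
move=> vom; rewrite !LieE (linB (contr_is_lin y)) contr_rotf // contr_mapf.
by rewrite opprD addrA addrAC.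
Qed.

(** Cartan's formula $\iota_x d + d \iota_x = L_x$, the recursion on which every identity for [ce]
    below rests. *)
Lemma contr_ce x om : validf om -> contr x (ce om) = Lie x om - ce (contr x om).
Proof.
move=> vom; rewrite !ceE LieE (linD (contr_is_lin x)) contr_brf // contr_actf.
by rewrite opprD addrACA.
Qed.

Lemma validf_Lie x om : validf om -> validf (Lie x om).
Proof.
move=> vom.
apply: (@validf_coind _ _ _ (fun o => exists a b, [/\ validf a, validf b
    & o = Lie x a + b])) => [_ y [a [b [va vb ->]]]|_ [a [b [va vb ->]]]
   |_ y [a [b [va vb ->]]]|]; last first.
- by exists om, 0; split; rewrite ?addr0 //; apply: validf0.
- rewrite (linD (contr_is_lin y)) (linD (contr_is_lin y)) (contr_diag _ vb) addr0.
  rewrite contr_Lie // (linB (contr_is_lin y)) contr_Lie; last exact: validf_contr.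
  by rewrite contr_diag // (lin0 (Lie_lin x)) sub0r contr_swap // opprK subrr.
- move=> c y z; rewrite !(linD (contr_is_lin _)) !contr_Lie //.
  rewrite (contr_lin vb) (contr_lin va) Lie_lin lie_brDr (contr_lin va).
  by rewrite opprD !scalerDr scalerN [X in X + _ = _]addrACA [LHS]addrACA.
rewrite (linD (contr_is_lin y)) contr_Lie //.
exists (contr y a), (contr y b - contr (br x y) a); split.
- exact: validf_contr.
- by apply: validfB; apply: validf_contr.
- by rewrite addrAC -addrA.
Qed.

Lemma validf_ce om : validf om -> validf (ce om).
Proof.
move=> vom.
apply: (@validf_coind _ _ _ (fun o => exists a b, [/\ validf a, validf b
    & o = ce a + b])) => [_ y [a [b [va vb ->]]]|_ [a [b [va vb ->]]]
   |_ y [a [b [va vb ->]]]|]; last first.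
- by exists om, 0; split; rewrite ?addr0 //; apply: validf0.
- rewrite (linD (contr_is_lin y)) (linD (contr_is_lin y)) (contr_diag _ vb) addr0.
  rewrite contr_ce // (linB (contr_is_lin y)) contr_ce; last exact: validf_contr.
  rewrite contr_Lie // lie_br_alt contr_diag // (lin0 ce_lin) subr0.
  by rewrite (lin0 (contr_lin va)) subr0 subrr.
- move=> c y z; rewrite !(linD (contr_is_lin _)) !contr_ce //.
  rewrite (contr_lin vb) (contr_lin va) ce_lin (Lie_linl va).
  by rewrite opprD !scalerDr scalerN [X in X + _ = _]addrACA [LHS]addrACA.
rewrite (linD (contr_is_lin y)) contr_ce // -(linN ce_lin).
exists (- contr y a), (Lie y a + contr y b); split.
- by apply: validfN; apply: validf_contr.
- by apply: validfD; [apply: validf_Lie|apply: validf_contr].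
- by rewrite addrCA addrA.
Qed.

Lemma br_br (x y z : g) : br (br x y) z = br x (br y z) - br y (br x z).
Proof.
apply/eqP; rewrite eq_sym subr_eq -subr_eq0; apply/eqP.
rewrite -[RHS](lie_jacobi g x y z) (br_anti (br x y) z) (br_anti z x) br_oppr.
by rewrite opprD opprK [X in _ + X]addrC addrA.
Qed.

(** Contraction by [z] reproduces the expression for $\iota_z \omega$, the extra terms cancelling by
    the Jacobi identity. In form degree 0 it is the axiom of a $\mathfrak g$-module. *)
Lemma Lie_Lie x y om : validf om ->
  Lie x (Lie y om) - Lie y (Lie x om) - Lie (br x y) om = 0.
Proof.
move=> vom; apply: (@fam0_coind _ _ _ (fun o => exists om, validf om /\
  o = Lie x (Lie y om) - Lie y (Lie x om) - Lie (br x y) om)); last by exists om.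
- move=> _ z [a [va ->]]; exists (contr z a); split; first exact: validf_contr.
  rewrite !(linB (contr_is_lin z)) !contr_Lie //; try exact: validf_Lie.
  rewrite !(linB (Lie_lin _)) br_br (linB (contr_lin va)).
  set D := contr (br x (br _ _)) a; set D' := contr (br y (br _ _)) a.
  set B := Lie x (contr (br _ _) _); set C := Lie y (contr (br _ _) _).
  rewrite !opprB; set A := Lie x (Lie y _); set A' := Lie y _; set F := Lie (br x y) _.
  by rewrite [X in X + _ = _]addrACA !subrKA addrA [X in X - F = _]addrAC !subrKA.
- move=> _ u [a [va ->]]; rewrite !famE /Lie /= !subr0.
  by rewrite gm_act_br subrr.
Qed.

(** By Cartan's formula, contraction by [y] turns the commutator at $\omega$ into the commutator at
    $-\iota_y \omega$; what remains cancels by [Lie_Lie]. *)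
Lemma Lie_ce x om : validf om -> Lie x (ce om) = ce (Lie x om).
Proof.
move=> vom; apply/eqP; rewrite -subr_eq0; apply/eqP.
apply: (@fam0_coind _ _ _ (fun o => exists om, validf om /\
  o = Lie x (ce om) - ce (Lie x om))); last by exists om.
- move=> _ y [a [va ->]]; exists (- contr y a).
  split; first by apply: validfN; apply: validf_contr.
  rewrite !(linB (contr_is_lin y)) contr_Lie //; last exact: validf_ce.
  rewrite !contr_ce //; last exact: validf_Lie.
  rewrite contr_Lie // !(linB (Lie_lin _)) !(linB ce_lin).
  rewrite !(linN ce_lin) !(linN (Lie_lin _)) !(linN ce_lin).
  have /eqP := Lie_Lie x y va; rewrite subr_eq0 => /eqP <-.
  rewrite !opprB opprK [X in X + _ = _]addrC [X in X + _ + _ = _]addrA subrKA.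
  by rewrite [LHS]addrC -[X in X + _ = _]addrA -opprD subrKA addrC.
- by move=> _ u [a [va ->]]; rewrite !famE /Lie /ce /= !addr0 (lin0 (act_linr x)) !subr0.
Qed.

(** $\iota_x d d = L_x d - d L_x + d d \iota_x = d d \iota_x$, so the class of all $d d \omega$ is
    stable under contraction. *)
Lemma ce_ce om : validf om -> ce (ce om) = 0.
Proof.
move=> vom; apply: (@fam0_coind _ _ _ (fun o => exists om, validf om /\
  o = ce (ce om))); last by exists om.
- move=> _ x [a [va ->]]; exists (contr x a); split; first exact: validf_contr.
  rewrite contr_ce //; last exact: validf_ce.
  by rewrite contr_ce // (linB ce_lin) Lie_ce // opprB addrC subrK.
- by move=> _ u [a [va ->]]; rewrite /ce /= addr0.
Qed.

End Cartan.

Arguments brf {K g M} om p u.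
Arguments rotf {K g M} x om p u.
Arguments Lie {K g M} x om p u.
Arguments ce {K g M} om p u.

(** * The Leibniz rule for the wedge product *)

Section Insertion.
Variables (T : Type) (x0 x : T).

Definition insert_at k (l : seq T) : seq T := take k l ++ x :: drop k l.

Lemma drop_insert_lt k r l : (k < r)%N -> drop r (insert_at k l) = drop r (x :: l).
Proof.
rewrite /insert_at; elim: k r l => [|k IH] [|r] [|y l] //= ltkr.
by rewrite IH //; case: r ltkr.
Qed.

Lemma drop_insert_ge k r l : (r <= k)%N ->
  drop r (insert_at k l) = insert_at (k - r) (drop r l) \/ (size l < k)%N.
Proof.
rewrite /insert_at; elim: r k l => [|r IH] [|k] [|y l] //=; rewrite ?subn0 ?drop0; try by left.
  by right.
by move=> lerk; have [->|?] := IH k l lerk; [left|right].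
Qed.

Lemma nth_insert_lt k l i : (i < k)%N -> (k <= size l)%N ->
  nth x0 (insert_at k l) i = nth x0 l i.
Proof. by move=> ltik lekl; rewrite nth_cat size_takel // ltik nth_take. Qed.

Lemma nth_insert_eq k l : (k <= size l)%N -> nth x0 (insert_at k l) k = x.
Proof. by move=> lekl; rewrite nth_cat size_takel // ltnn subnn. Qed.

Lemma nth_insert_bump k l j : (k <= size l)%N ->
  nth x0 (insert_at k l) (bump k j) = nth x0 l j.
Proof.
move=> lekl; rewrite /bump; case: leqP => [lekj|ltjk].
  rewrite add1n nth_cat size_takel // ltnNge leqW //= subSn //= nth_drop.
  by rewrite subnKC.
by rewrite add0n nth_insert_lt.
Qed.

Lemma size_insert_at k l : size (insert_at k l) = (size l).+1.
Proof. by rewrite size_cat /= addnS -size_cat cat_take_drop. Qed.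

End Insertion.

(** Permutations are sorted by the position [k] that they send to 0, as in a Laplace expansion. This
    tracks where the first argument goes in the sum over permutations that defines the wedge
    product. *)
Lemma sum_lift_perm (Z : zmodType) p (F : 'S_p.+1 -> Z) :
  \sum_s F s = \sum_(s : 'S_p) \sum_k F (lift_perm k ord0 s).
Proof.
rewrite exchange_big /=.
rewrite (partition_big (fun s : 'S_p.+1 => (s^-1)%g ord0) predT) //=.
apply: eq_bigr => k _.
rewrite (reindex (lift_perm k ord0)) /=; last first.
  pose ulsf i (s : 'S_p.+1) j := odflt j (unlift (s i) (s (lift i j))).
  have ulsfK i (s : 'S_p.+1) j : lift (s i) (ulsf i s j) = s (lift i j).
    rewrite /ulsf; have := neq_lift i j.
    by rewrite -(can_eq (permK s)) => /unlift_some[] ? ? ->.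
  have inj_ulsf : injective (ulsf k _).
    move=> s; apply: can_inj (ulsf (s k) s^-1%g) _ => j.
    by rewrite {1}/ulsf ulsfK !permK liftK.
  exists (fun s => perm (inj_ulsf s)) => [s _ | s].
    by apply/permP=> j; rewrite permE /ulsf lift_perm_lift lift_perm_id liftK.
  rewrite inE => /eqP sk; have {}sk : s k = ord0 by rewrite -sk permKV.
  apply/permP=> i; case: (unliftP k i) => [j|] ->; rewrite ?lift_perm_id //.
  by rewrite lift_perm_lift -sk permE ulsfK.
apply: eq_bigl => s; apply/eqP.
by rewrite -{2}(lift_perm_id k ord0 s) permK.
Qed.

Lemma sum_if_lt (Z : zmodType) n r (a b : Z) : (r <= n)%N ->
  \sum_(k < n) (if (k < r)%N then a else b) = a *+ r + b *+ (n - r).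
Proof.
move=> lern; rewrite -(big_mkord xpredT (fun k => if (k < r)%N then a else b)).
rewrite (big_cat_nat _ lern) //=; congr (_ + _).
  rewrite (eq_big_nat _ _ (F2 := fun=> a)) ?sumr_const_nat ?subn0 // => i /andP[_].
  by move=> ->.
rewrite (eq_big_nat _ _ (F2 := fun=> b)) ?sumr_const_nat // => i /andP[+ _].
by rewrite ltnNge => ->.
Qed.

Section Wedge.
Variables (K : fieldType) (g : lie_algebra K).
Hypothesis charK : [pchar K] =i pred0.
Local Notation fam M := (fam g M).

(** The inserted entry reaches the front by [k] adjacent exchanges. *)
Lemma altmap_insert (M : lmodType K) n (phi : tup g n.+1 -> M) x k l :
  altmap phi -> (k <= n)%N -> (k <= size l)%N ->
  phi (tmk n.+1 (insert_at x k l)) = (-1) ^+ k *: phi (tmk n.+1 (x :: l)).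
Proof.
rewrite /insert_at.
elim: k n phi l => [|k IH] n phi l aphi.
  by rewrite take0 drop0 expr0 scale1r.
case: n phi aphi => [|n] phi aphi //; case: l => [|y l] //= lekn lekl.
rewrite tmk_cons (IH _ (fun u => phi (tcons y u))) //; last exact: altmap_tcons.
by rewrite !tmk_cons altmap_swap // exprS mulN1r scaleNr scalerN.
Qed.

Definition perm_tup p (u : tup g p) (s : 'S_p) : tup g p := [ffun k => u (s k)].

Lemma args_perm_tcons p x (u : tup g p) k s :
  args (perm_tup (tcons x u) (lift_perm k ord0 s)) =
  insert_at x k (args (perm_tup u s)).
Proof.
apply: (@eq_from_nth _ 0); first by rewrite size_insert_at !size_args.
move=> i; rewrite size_args => ltip.
have lek : (k <= size (args (perm_tup u s)))%N by rewrite size_args -ltnS.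
rewrite (nth_args _ (Ordinal ltip)) ffunE.
rewrite -[i in RHS]/(nat_of_ord (Ordinal ltip)).
case: (unliftP k (Ordinal ltip)) => [j|] ->.
  by rewrite lift_perm_lift tconsS nth_insert_bump // nth_args ffunE.
by rewrite lift_perm_id tcons0 nth_insert_eq.
Qed.

Section WedgeFam.
Variable M : lmodType K.

Definition wdg r (theta : tup g r -> K^o) (om : fam M) : fam M := fun p u =>
  if (r <= p)%N then
    ((r`! * (p - r)`!)%:R^-1 : K) *: \sum_(s : 'S_p)
      (((-1) ^+ s * theta (tmk r (args (perm_tup u s)))) *:
       om (p - r)%N (tmk (p - r) (drop r (args (perm_tup u s)))))
  else 0.
Arguments wdg {r} theta om p u.

Lemma fam_tmk_eq (om : fam M) n n' l : n = n' -> om n (tmk n l) = om n' (tmk n' l).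
Proof. by move=> ->. Qed.

(** The entry [x] lands at a position [k] either among the first [r] arguments, those of [theta], or
    among those of [om]. Moving it to the front there absorbs the dependence on [k], so the two
    cases occur with multiplicities $r$ and $p+1-r$. The second one keeps the sign $(-1)^k
    (-1)^{k-r} = (-1)^r$. *)
Lemma wdg_sum_tcons r (theta : tup g r -> K^o) (om : fam M) p x (u : tup g p) :
  altmap theta -> validf om -> (r <= p.+1)%N ->
  \sum_(s : 'S_p.+1) ((-1) ^+ s * theta (tmk r (args (perm_tup (tcons x u) s)))) *:
     om (p.+1 - r)%N (tmk (p.+1 - r) (drop r (args (perm_tup (tcons x u) s)))) =
  (\sum_(s : 'S_p) ((-1) ^+ s * theta (tmk r (x :: args (perm_tup u s))) : K) *:
     om (p.+1 - r)%N (tmk (p.+1 - r) (drop r (x :: args (perm_tup u s))))) *+ r +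
  ((-1) ^+ r *: \sum_(s : 'S_p) ((-1) ^+ s * theta (tmk r (args (perm_tup u s))) : K) *:
     om (p.+1 - r)%N (tmk (p.+1 - r) (x :: drop r (args (perm_tup u s)))))
     *+ (p.+1 - r).
Proof.
move=> ath vom lerp; rewrite sum_lift_perm scaler_sumr -!sumrMnl -big_split /=.
apply: eq_bigr => s _; rewrite -sum_if_lt //; apply: eq_bigr => k _.
rewrite args_perm_tcons; set L := args _.
have lekL : (k <= size L)%N by rewrite size_args -ltnS.
have -> : (-1) ^+ lift_perm k ord0 s = (-1) ^+ k * (-1) ^+ s :> K.
  by rewrite odd_lift_perm /= addbF signr_addb signr_odd.
case: ltnP => [ltkr|lerk].
  rewrite drop_insert_lt //; congr (_ *: _).
  case: r theta ath ltkr {lerp} => [|r] theta ath // ltkr.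
  rewrite (altmap_insert (M := K^o)) // -[_ *: _]/(_ * _).
  by rewrite mulrACA -expr2 sqrr_sign mul1r.
have -> : tmk r (insert_at x k L) = tmk r L.
  apply/ffunP=> i; rewrite !ffunE nth_insert_lt //.
  exact: leq_trans (ltn_ord i) lerk.
have [->|] := drop_insert_ge x L lerk; last by rewrite ltnNge lekL.
have lerp' : (r <= p)%N by rewrite -ltnS; apply: leq_trans (ltn_ord k).
rewrite subSn // altmap_insert //; last by rewrite size_drop leq_sub2r.
  rewrite !scalerA; congr (_ *: _).
  have e : (-1) ^+ k * (-1) ^+ (k - r) = (-1) ^+ r :> K.
    by rewrite -signr_odd -[(-1) ^+ (k - r)]signr_odd -signr_addb oddB // addKb signr_odd.
  by rewrite -[X in X * _]mulrA mulrAC e.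
by rewrite leq_sub2r // -ltnS.
Qed.

Lemma contr_wdg0 (theta : tup g 0 -> K^o) om x : validf om ->
  contr x (wdg theta om) = wdg theta (contr x om).
Proof.
move=> vom; apply: famP => p u; rewrite /contr /wdg !leq0n.
rewrite wdg_sum_tcons //; last exact: altmap0.
rewrite mulr0n add0r expr0 scale1r -scaler_nat scalerA subn0 fact0 !mul1n subn0 factS.
rewrite natrM invfM mulrAC mulVf ?mul1r; last by rewrite (pcharf0P K).1.
by congr (_ *: _); apply: eq_bigr => s _; rewrite !drop0 tmk_cons.
Qed.

(** Graded Leibniz rule for $\iota_x$. The multiplicities $r+1$ and $p-r$ of [wdg_sum_tcons] cancel
    one factor of $(r+1)!$ and of $(p-r)!$ respectively, which uses characteristic zero. *)
Lemma contr_wdg r (theta : tup g r.+1 -> K^o) om x : altmap theta -> validf om ->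
  contr x (wdg theta om) =
  wdg (fun u => theta (tcons x u)) om + (-1) ^+ r.+1 *: wdg theta (contr x om).
Proof.
move=> ath vom; apply: famP => p u; rewrite !famE /contr /wdg ltnS.
have nz n : n.+1%:R != 0 :> K by rewrite (pcharf0P K).1.
case: (leqP r p) => [lerp|ltpr]; last first.
  by rewrite ltnNge ltnW //= ?scaler0 ?addr0 // leqW.
rewrite wdg_sum_tcons // scalerDr; congr (_ + _).
  rewrite -scaler_nat scalerA factS -mulnA natrM invfM mulrAC mulVf ?nz // mul1r.
  rewrite subSS; congr (_ *: _); apply: eq_bigr => s _.
  by rewrite tmk_cons.
case: (ltnP r p) => [ltrp|lepr]; last first.
  by rewrite (eqP (_ : p.+1 - r.+1 == 0)%N) ?mulr0n ?scaler0 // subn_eq0.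
have En : (p.+1 - r.+1 = (p - r.+1).+1)%N by rewrite subSS subnSK.
rewrite -scaler_nat [LHS]scalerA [LHS]scalerA [RHS]scalerA; congr (_ *: _).
  rewrite mulrC; congr (_ * _); rewrite En factS mulnCA natrM invfM mulrAC.
  by rewrite mulVf ?nz // mul1r.
apply: eq_bigr => s _; congr (_ *: _); rewrite (fam_tmk_eq om _ En).
by rewrite tmk_cons.
Qed.

End WedgeFam.
End Wedge.

Arguments wdg {K g M r} theta om p u.

(** * Wedge products: linearity over forms, Euler's identity, vanishing above the dimension *)

Section WedgeTheory.
Variables (K : fieldType) (g : lie_algebra K).
Hypothesis charK : [pchar K] =i pred0.
Local Notation fam M := (fam g M).
Implicit Type M : lmodType K.

Lemma wdg_lin M r (theta : tup g r -> K^o) : lin (wdg theta : fam M -> fam M).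
Proof.
move=> a v w; apply: famP => p u; rewrite !famE /wdg.
case: leqP => _; last by rewrite scaler0 addr0.
rewrite scalerA mulrC -scalerA -scalerDr; congr (_ *: _).
rewrite scaler_sumr -big_split /=; apply: eq_bigr => s _.
by rewrite !famE scalerDr !scalerA [_ * a]mulrC.
Qed.

Lemma wdg_linl M r (th1 th2 : tup g r -> K^o) a (om : fam M) :
  wdg (fun u => a *: th1 u + th2 u) om = a *: wdg th1 om + wdg th2 om.
Proof.
apply: famP => p u; rewrite !famE /wdg.
case: leqP => _; last by rewrite scaler0 addr0.
rewrite scalerA mulrC -scalerA -scalerDr; congr (_ *: _).
rewrite scaler_sumr -big_split /=; apply: eq_bigr => s _.
rewrite -[a *: th1 _]/(a * th1 _).
by rewrite mulrDr scalerDl [X in X *: _]mulrCA [in RHS]scalerA.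
Qed.

Lemma mapf_wdg M M' (t : M -> M') r (theta : tup g r -> K^o) om : lin t ->
  mapf t (wdg theta om) = wdg theta (mapf t om).
Proof.
move=> tl; apply: famP => p u; rewrite /mapf /wdg.
case: leqP => _; last exact: lin0.
rewrite linZ // lin_sum //; congr (_ *: _).
by apply: eq_bigr => s _; rewrite linZ.
Qed.

Lemma wdg0E M (theta : tup g 0 -> K^o) (om : fam M) (c : K) :
  (forall u, theta u = c) -> validf om -> wdg theta om = c *: om.
Proof.
move=> thc vom; apply: famP => p; elim: p om vom => [|p IH] om vom u.
  rewrite famE /wdg leqnn fact0 mul1n invr1 scale1r.
  rewrite (big_pred1 1%g); last by move=> s /=; apply/esym/eqP/permP; case.
  rewrite odd_perm1 expr0 mul1r thc; congr (_ *: _).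
  by rewrite [u in RHS](tup0_eq _ (tmk 0 (drop 0 (args (perm_tup u 1%g))))).
rewrite (tupS_eq u); set x := u ord0; set u' := finfun _.
by rewrite -[LHS]/(contr x (wdg theta om) p u') contr_wdg0 // IH ?famE //; apply: validf_contr.
Qed.

Lemma wdg_zero M r (om : fam M) : wdg (fun _ : tup g r => 0 : K^o) om = 0.
Proof.
apply: famP => p u; rewrite famE /wdg; case: leqP => // _.
by rewrite big1 ?scaler0 // => s _; rewrite mulr0 scale0r.
Qed.

Lemma fam_sumE M (I : Type) (r : seq I) (F : I -> fam M) p u :
  (\sum_(i <- r) F i) p u = \sum_(i <- r) F i p u.
Proof. by apply: (big_morph (fun o : fam M => o p u)) => [o1 o2|]; rewrite famE. Qed.

(** Contracting a wedge product gives a combination of wedge products of other factors. Their span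
    is thus a class to which [validf_coind] applies. *)
Inductive wdg_span M : fam M -> Prop :=
| WdgSpan r (theta : tup g r -> K^o) om :
    altmap theta -> validf om -> wdg_span (wdg theta om)
| WdgSpanLin a o1 o2 : wdg_span o1 -> wdg_span o2 -> wdg_span (a *: o1 + o2).

Lemma validf_wdg M r (theta : tup g r -> K^o) (om : fam M) :
  altmap theta -> validf om -> validf (wdg theta om).
Proof.
move=> ath vom; have : wdg_span (wdg theta om) by apply: WdgSpan.
apply: validf_coind => {r theta om ath vom} o.
- move=> x; elim=> [r theta om ath vom|a o1 o2 _ w1 _ w2]; last first.
    by rewrite contr_is_lin; apply: WdgSpanLin.
  case: r theta ath => [|r] theta ath.
    by rewrite contr_wdg0 //; apply: WdgSpan => //; apply: validf_contr.
  rewrite contr_wdg // addrC; apply: WdgSpanLin; apply: WdgSpan => //.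
    exact: validf_contr.
  exact: altmap_tcons.
- elim=> [r theta om ath vom|a o1 o2 _ l1 _ l2] b x y; last first.
    rewrite !contr_is_lin l1 l2 !scalerDr [LHS]addrACA; congr (_ + _ + _).
    by rewrite !scalerA mulrC.
  case: r theta ath => [|r] theta ath.
    by rewrite !contr_wdg0 // (contr_lin vom) wdg_lin.
  rewrite !contr_wdg // (contr_lin vom) wdg_lin.
  have -> : (fun u => theta (tcons (b *: x + y) u)) =
            (fun u => b *: (theta (tcons x u) : K^o) + theta (tcons y u)).
    by apply: funext => u; apply: (altmap_lin u ath).
  rewrite wdg_linl !scalerDr [LHS]addrACA; congr (_ + _ + _).
  by rewrite !scalerA mulrC.
- move=> x; elim=> [r theta om ath vom|a o1 o2 _ d1 _ d2]; last first.
    by rewrite !contr_is_lin d1 d2 scaler0 addr0.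
  case: r theta ath => [|r] theta ath.
    rewrite !contr_wdg0 //; last exact: validf_contr.
    by rewrite contr_diag // (lin0 (wdg_lin _)).
  have vxom := validf_contr x vom.
  rewrite contr_wdg // addrC contr_is_lin contr_wdg // contr_diag //.
  rewrite (lin0 (wdg_lin _)) scaler0 addr0.
  case: r theta ath => [|r] theta ath.
    by rewrite contr_wdg0 // expr1 scaleN1r addNr.
  rewrite contr_wdg //; last exact: altmap_tcons.
  have -> : (fun u => theta (tcons x (tcons x u))) = (fun=> 0).
    by apply: funext => u; rewrite altmap_diag.
  by rewrite wdg_zero add0r exprS mulN1r scaleNr addNr.
Qed.

(** [actf eta] is $\sum_a e^a \wedge \eta(e_a)$, the wedge product with an operator-valued 1-form;
    it passes an [r]-form at the cost of $(-1)^r$. The proof compares contractions, by induction on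
    the form degree. *)
Lemma actf_wdg M M' (eta : g -> M -> M') r (theta : tup g r -> K^o) om :
  (forall x, lin (eta x)) -> (forall v, lin (fun x : g => eta x v)) ->
  altmap theta -> validf om ->
  actf eta (wdg theta om) = (-1) ^+ r *: wdg theta (actf eta om).
Proof.
move=> elr ell ath vom; apply: famP => p.
elim: p r theta om ath vom => [|p IH] r theta om ath vom u.
  rewrite famE /wdg; case: r theta {ath} => [|r] theta /=; last by rewrite scaler0.
  by rewrite big1 ?scaler0 // => s _; rewrite scaler0.
rewrite (tupS_eq u); set x := u ord0; set u' := finfun _.
rewrite -[LHS]/(contr x (actf eta (wdg theta om)) p u') famE.
rewrite -[wdg _ _ _ _]/(contr x (wdg theta (actf eta om)) p u').
have vxom := validf_contr x vom; have vA := validf_actf elr ell vom.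
rewrite contr_actf mapf_wdg //; case: r theta ath => [|r] theta ath.
  rewrite !contr_wdg0 // contr_actf (linB (wdg_lin _)) !famE expr0 scale1r.
  by rewrite IH // expr0 scale1r.
rewrite !contr_wdg // contr_actf (linD (actf_lin elr)) (linZ (actf_lin elr)).
rewrite (linB (wdg_lin _)) !famE !IH //; last exact: altmap_tcons.
rewrite !famE scalerDr scalerBr scalerBr !scalerA -!expr2 !sqrr_sign !scale1r.
by rewrite exprS mulN1r scaleNr opprD addrCA.
Qed.

Let b := vbasis (fullv : {vspace g}).

Definition coord_form (a : 'I_(\dim (fullv : {vspace g}))) (u : tup g 1) : K^o :=
  coord b a (u ord0).

Lemma altmap_coord_form a : altmap (coord_form a).
Proof.
split=> [u i c x y|u i j]; last by rewrite !ord1 eqxx.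
by rewrite /coord_form !ffunE !ord1 eqxx linearP.
Qed.

(** Contracting $\sum_a e^a \wedge \iota_{e_a} \omega$ by [x] gives $\sum_a e^a(x)\, \iota_{e_a}
    \omega = \iota_x \omega$ plus the same sum for $\iota_x \omega$, so each form degree adds one
    copy. *)
Lemma euler_wdg M (om : fam M) p u : validf om ->
  \sum_a wdg (coord_form a) (contr b`_a om) p u = p%:R *: om p u.
Proof.
elim: p om u => [|p IH] om u vom.
  by rewrite scale0r big1.
rewrite (tupS_eq u); set x := u ord0; set u' := finfun _.
transitivity (\sum_a (coord b a x *: contr b`_a om p u' +
   wdg (coord_form a) (contr b`_a (contr x om)) p u')).
  apply: eq_bigr => a _; rewrite -[LHS]/(contr x (wdg _ _) p u').
  have va := validf_contr b`_a vom.
  rewrite contr_wdg //; last exact: altmap_coord_form.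
  rewrite (@wdg0E _ _ _ (coord b a x)) //; last first.
    by move=> v; rewrite /coord_form tcons0.
  by rewrite !famE contr_swap // (linN (wdg_lin _)) expr1 scaleN1r famE opprK.
rewrite big_split /= IH; last exact: validf_contr.
rewrite mulrS scalerDl scale1r; congr (_ + _).
rewrite -[RHS]/(contr x om p u').
rewrite {2}(coord_vbasis (memvf x)) (lin_sum (contr_lin vom)).
rewrite fam_sumE; apply: eq_bigr => a _.
by rewrite (linZ (contr_lin vom)) famE.
Qed.

Lemma altmap_eq0 M p (phi : tup g p -> M) u :
  altmap phi -> (\dim (fullv : {vspace g}) < p)%N -> phi u = 0.
Proof.
move=> [mphi aphi] ltp; pose X := [tuple u i | i < p].
have : ~~ free X.
  apply/negP; rewrite /free => /eqP dX; move: ltp.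
  by rewrite ltnNge -{1}(size_tuple X) -dX dimvS // subvf.
move=> nfree.
have [k [kX [j kj]]] : exists k : 'I_p -> K,
    \sum_i k i *: X`_i = 0 /\ exists j, k j != 0.
  apply: contrapT => nex; case/negP: nfree; apply/freeP => k kX i.
  by apply/eqP; apply: contrapT => /negP ki; apply: nex; exists k; split; [|exists i].
have phil : lin (fun x => phi (upd u j x)) by move=> a x y; apply: mphi.
have -> : u = upd u j (u j) by apply/ffunP=> i; rewrite ffunE; case: eqP => [->|].
have XE (i : 'I_p) : X`_i = u i by rewrite -tnth_nth tnth_mktuple.
(* The linear relation between the entries is put in slot [j], where its coefficient is non-zero.
   Every other term repeats an entry, which leaves $k_j \phi(u) = 0$. *)
move/(congr1 (fun x => phi (upd u j x))): kX; rewrite (lin_sum phil) (lin0 phil).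
rewrite (bigD1 j) //= big1 ?addr0 => [|i neij].
  by rewrite XE (linZ phil) => /eqP; rewrite scaler_eq0 (negbTE kj) => /eqP.
rewrite XE (linZ phil) (aphi _ i j) ?scaler0 // !ffunE eqxx.
by case: eqP neij.
Qed.

End WedgeTheory.

(** * Cochains with values in a dg module *)

Arguments addc {K g V} om1 om2 p q u.
Arguments oppc {K g V} om p q u.
Arguments scalec {K g V} a om p q u.
Arguments wedge {K g V r} theta om p q u.
Arguments dCE {K g V} om p q u.
Arguments dint {K g V} om p q u.
Arguments dtot {K g V} om p q u.
Arguments incl0 {K g V} v p q _.

Section Sign.
Variables (K : fieldType) (g : lie_algebra K).
Local Notation fam M := (fam g M).

(** The Koszul sign by which an operator of odd degree on the coefficients is extended to forms, as
    in [dint]. *)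
Definition sgnf (M : lmodType K) (om : fam M) : fam M := fun p u => (-1) ^+ p *: om p u.
Arguments sgnf {M} om p u.

Lemma sgnf_lin (M : lmodType K) : lin (sgnf : fam M -> fam M).
Proof.
move=> a v w; apply: famP => p u.
by rewrite /sgnf !famE scalerDr !scalerA mulrC.
Qed.

Lemma validf_sgnf (M : lmodType K) (om : fam M) : validf om -> validf (sgnf om).
Proof.
move=> vom p; apply: (altmap_map (t := fun v => (-1) ^+ p *: v)) => // a x y.
by rewrite scalerDr !scalerA mulrC.
Qed.

Lemma wdg_sgnf (M : lmodType K) r (theta : tup g r -> K^o) (om : fam M) :
  wdg theta (sgnf om) = (-1) ^+ r *: sgnf (wdg theta om).
Proof.
apply: famP => p u; rewrite famE /sgnf /wdg; case: leqP => lerp; last by rewrite !scaler0.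
rewrite !scalerA mulrC -scalerA; congr (_ *: _); rewrite scaler_sumr.
apply: eq_bigr => s _; rewrite !scalerA mulrC; congr (_ * _ *: _).
by rewrite -exprD -signr_odd oddB // addbC -oddD signr_odd.
Qed.

Lemma brf_sgnf (M : lmodType K) (om : fam M) : brf (sgnf om) = - sgnf (brf om).
Proof.
apply: famP => -[|m] u; rewrite famE /sgnf /= ?scaler0 ?oppr0 //.
rewrite exprS mulN1r scaleNr opprK scaler_sumr; apply: eq_bigr => i _.
rewrite scaler_sumr; apply: eq_bigr => j _.
by rewrite !scalerA mulrC.
Qed.

Lemma actf_sgnf (M M' : lmodType K) (eta : g -> M -> M') (om : fam M) :
  (forall x, lin (eta x)) -> actf eta (sgnf om) = - sgnf (actf eta om).
Proof.
move=> el; apply: famP => -[|m] u; rewrite famE /sgnf /= ?scaler0 ?oppr0 //.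
rewrite exprS mulN1r scaleNr opprK scaler_sumr; apply: eq_bigr => i _.
by rewrite (linZ (el _)) !scalerA mulrC.
Qed.

Lemma brf_mapf (M M' : lmodType K) (t : M -> M') (om : fam M) : lin t ->
  brf (mapf t om) = mapf t (brf om).
Proof.
move=> tl; apply: famP => -[|m] u; rewrite /mapf /= ?lin0 //.
rewrite lin_sum //; apply: eq_bigr => i _; rewrite lin_sum //; apply: eq_bigr => j _.
by rewrite linZ.
Qed.

(* The brackets cancel: only the defect of equivariance of [t] survives. *)
Lemma ce_sgnf_mapf (M M' : gmodule g) (t : M -> M') (om : fam M) : lin t ->
  ce (sgnf (mapf t om)) + sgnf (mapf t (ce om)) =
  - sgnf (actf (fun x v => gm_act x (t v) - t (gm_act x v)) om).
Proof.
move=> tl; rewrite !ceE brf_sgnf actf_sgnf; last by move=> x; apply: act_linr.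
rewrite brf_mapf // (linD (mapf_lin tl)) (linD (sgnf_lin (M:=_))).
rewrite addrACA addNr addr0 -!(linN (sgnf_lin (M:=_))) -(linD (sgnf_lin (M:=_))).
congr sgnf; apply: famP => -[|m] u; rewrite !famE /mapf /= ?(lin0 tl) ?oppr0 ?addr0 //.
rewrite (lin_sum tl) -!sumrN -big_split /=; apply: eq_bigr => i _.
by rewrite (linZ tl) scalerBr opprB addrC.
Qed.

End Sign.
Arguments sgnf {K g M} om p u.

(** * The total complex, read in rows of fixed internal degree *)

Section Cochains.
Variables (K : fieldType) (g : lie_algebra K).
Hypothesis charK : [pchar K] =i pred0.
Implicit Types V W : dgmodule g.

Lemma cochainP V (om1 om2 : cochain V) : ceq om1 om2 -> om1 = om2.
Proof.
move=> e; apply: functional_extensionality_dep => p.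
by apply: functional_extensionality_dep => q; apply: funext.
Qed.

Definition qrow V (om : cochain V) q : fam g (dg_obj V q) := fun p => om p q.
Arguments qrow {V} om q p u.

Definition dg_gmodule V q : gmodule g :=
  GModule (@dg_actDl K g V q) (@dg_actDr K g V q) (@dg_act_br K g V q).

Definition zeroc V : cochain V := fun p q u => 0.
Arguments zeroc {V} p q u.

Lemma dg_d_is_lin V q : lin (@dg_d K g V q).
Proof. by move=> a v w; apply: dg_d_lin. Qed.

Lemma valid_qrow V (om : cochain V) : valid om <-> forall q, validf (qrow om q).
Proof. by split=> vom p q; apply: vom. Qed.

Lemma qrow_addc V (om1 om2 : cochain V) q : qrow (addc om1 om2) q = qrow om1 q + qrow om2 q.
Proof. by apply: famP => p u; rewrite famE. Qed.

Lemma qrow_oppc V (om : cochain V) q : qrow (oppc om) q = - qrow om q.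
Proof. by apply: famP => p u; rewrite famE. Qed.

Lemma qrow_scalec V a (om : cochain V) q : qrow (scalec a om) q = a *: qrow om q.
Proof. by apply: famP => p u; rewrite famE. Qed.

Lemma qrow_wedge V r (theta : tup g r -> K^o) (om : cochain V) q :
  qrow (wedge theta om) q = wdg theta (qrow om q).
Proof.
apply: famP => p u; rewrite /qrow /wedge /wdg; case: leqP => // _; congr (_ *: _).
apply: eq_bigr => s _; congr ((_ * theta _) *: om _ _ _).
by apply/ffunP=> j; rewrite !ffunE nth_drop.
Qed.

Lemma qrow_dCE V (om : cochain V) q :
  qrow (dCE om) q = ce (qrow om q : fam g (dg_gmodule V q)).
Proof. by apply: famP => -[|m] u; rewrite /ce /= ?addr0. Qed.

Lemma qrow_dintS V (om : cochain V) q :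
  qrow (dint om) q.+1 = sgnf (mapf (@dg_d K g V q) (qrow om q)).
Proof. by []. Qed.

Lemma qrow_dint0 V (om : cochain V) : qrow (dint om) 0 = 0.
Proof. by apply: famP => p u; rewrite famE. Qed.

Lemma qrowP V (om1 om2 : cochain V) : (forall q, qrow om1 q = qrow om2 q) -> om1 = om2.
Proof.
move=> e; apply: cochainP => p q u.
by rewrite -[LHS]/(qrow om1 q p u) e.
Qed.

Lemma valid_addc V (om1 om2 : cochain V) : valid om1 -> valid om2 -> valid (addc om1 om2).
Proof.
move=> /valid_qrow v1 /valid_qrow v2; apply/valid_qrow=> q.
by rewrite qrow_addc; apply: validfD.
Qed.

Lemma valid_oppc V (om : cochain V) : valid om -> valid (oppc om).
Proof. by move=> /valid_qrow v1; apply/valid_qrow=> q; rewrite qrow_oppc; apply: validfN. Qed.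

Lemma valid_zeroc V : valid (@zeroc V).
Proof. by move=> p q; split=> [u i a x y|]; rewrite /zeroc ?scaler0 ?addr0. Qed.

Lemma valid_wedge V r (theta : tup g r -> K^o) (om : cochain V) :
  altmap theta -> valid om -> valid (wedge theta om).
Proof.
by move=> ath /valid_qrow v1; apply/valid_qrow=> q; rewrite qrow_wedge; apply: validf_wdg.
Qed.

Lemma valid_dtot V (om : cochain V) : valid om -> valid (dtot om).
Proof.
move=> /valid_qrow v1; apply: valid_addc; apply/valid_qrow=> q.
  by rewrite qrow_dCE; apply: (@validf_ce _ _ (dg_gmodule V q) _ (v1 q)).
case: q => [|q]; first by rewrite qrow_dint0; apply: validf0.
rewrite qrow_dintS; apply: validf_sgnf; apply: validf_mapf => //.
exact: dg_d_is_lin.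
Qed.

Lemma dtot_addc V (om1 om2 : cochain V) :
  dtot (addc om1 om2) = addc (dtot om1) (dtot om2).
Proof.
apply: qrowP => q; rewrite /dtot !qrow_addc !qrow_dCE qrow_addc (linD (ce_lin (M:=_))).
rewrite [RHS]addrACA; congr (_ + _).
case: q => [|q]; first by rewrite !qrow_dint0 addr0.
by rewrite !qrow_dintS qrow_addc (linD (mapf_lin (@dg_d_is_lin V q))) (linD (sgnf_lin (M:=_))).
Qed.

Lemma dtot_oppc V (om : cochain V) : dtot (oppc om) = oppc (dtot om).
Proof.
apply: qrowP => q; rewrite /dtot qrow_oppc !qrow_addc !qrow_dCE qrow_oppc (linN (ce_lin (M:=_))).
rewrite opprD; congr (_ + _).
case: q => [|q]; first by rewrite !qrow_dint0 oppr0.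
by rewrite !qrow_dintS qrow_oppc (linN (mapf_lin (@dg_d_is_lin V q))) (linN (sgnf_lin (M:=_))).
Qed.

(** The pure parts vanish by [ce_ce] and [dg_dd]. The mixed part is the anticommutator computed in
    [ce_sgnf_mapf], whose defect is zero because $d^V$ is equivariant. *)
Lemma dtot_dtot V (om : cochain V) : valid om -> dtot (dtot om) = zeroc.
Proof.
move=> /valid_qrow vom; apply: qrowP => q.
have -> : qrow (@zeroc V) q = 0 by apply: famP => p u; rewrite famE.
rewrite /dtot !qrow_addc !qrow_dCE qrow_addc (linD (ce_lin (M:=_))) qrow_dCE.
rewrite (ce_ce (M:=dg_gmodule V q) (vom q)) add0r.
case: q => [|q].
  by rewrite !qrow_dint0 (lin0 (ce_lin (M:=_))) addr0.
rewrite !qrow_dintS qrow_addc (linD (mapf_lin (@dg_d_is_lin V q))) (linD (sgnf_lin (M:=_))).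
rewrite qrow_dCE addrA.
rewrite (ce_sgnf_mapf (M:=dg_gmodule V q) (M':=dg_gmodule V q.+1) _ (@dg_d_is_lin V q)).
have -> : actf (fun (x : g) (v : dg_gmodule V q) =>
    @gm_act K g (dg_gmodule V q.+1) x (dg_d v) - dg_d (gm_act x v)) (qrow om q) = 0.
  apply: famP => -[|m] u; rewrite famE //= big1 // => i _.
  by rewrite dg_d_equiv subrr scaler0.
rewrite (lin0 (sgnf_lin (M:=_))) oppr0 add0r.
apply: famP => p u; rewrite famE /sgnf /mapf /qrow /=; case: q => [|q] /=.
  by rewrite (lin0 (@dg_d_is_lin V _)) scaler0.
by rewrite (linZ (@dg_d_is_lin V _)) dg_dd !scaler0.
Qed.

End Cochains.

(** * Maps linear over the forms *)

Arguments qrow {K g V} om q p u.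
Arguments zeroc {K g V} p q u.

Section OmegaLinear.
Variables (K : fieldType) (g : lie_algebra K).
Hypothesis charK : [pchar K] =i pred0.
Implicit Types V W : dgmodule g.

Lemma scale0c V (om : cochain V) : scalec 0 om = zeroc.
Proof. by apply: cochainP => p q u; rewrite /scalec scale0r. Qed.

Lemma scale1c V (om : cochain V) : scalec 1 om = om.
Proof. by apply: cochainP => p q u; rewrite /scalec scale1r. Qed.

Lemma wedge_addc V r (theta : tup g r -> K^o) (om1 om2 : cochain V) :
  wedge theta (addc om1 om2) = addc (wedge theta om1) (wedge theta om2).
Proof. by apply: qrowP => q; rewrite qrow_addc !qrow_wedge qrow_addc (linD (wdg_lin _)). Qed.

Lemma wedge_scalec V r (theta : tup g r -> K^o) a (om : cochain V) :
  wedge theta (scalec a om) = scalec a (wedge theta om).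
Proof. by apply: qrowP => q; rewrite qrow_scalec !qrow_wedge qrow_scalec (linZ (wdg_lin _)). Qed.

Lemma scalec0 V a : scalec a (@zeroc K g V) = zeroc.
Proof. by apply: cochainP => p q u; rewrite /scalec scaler0. Qed.

Lemma wedge0 V r (theta : tup g r -> K^o) : wedge theta (@zeroc K g V) = zeroc.
Proof. by rewrite -[X in wedge _ X](scale0c zeroc) wedge_scalec scale0c. Qed.

Section Values.
Variables (V W : dgmodule g) (k : int) (F : cochain V -> cochain W).
Hypothesis Fk : omega_linear k F.

Lemma omega_linear_valid om : valid om -> valid (F om).
Proof. by case: Fk => Fv _ _ _ _; apply: Fv. Qed.

Lemma omega_linearD om1 om2 : valid om1 -> valid om2 ->
  F (addc om1 om2) = addc (F om1) (F om2).
Proof. by case: Fk => _ FD _ _ _ v1 v2; apply: cochainP; apply: FD. Qed.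

Lemma omega_linearZ a om : valid om -> F (scalec a om) = scalec a (F om).
Proof. by case: Fk => _ _ FZ _ _ v; apply: cochainP; apply: FZ. Qed.

Lemma omega_linear_homog n om : valid om -> homog n om -> homog (n + k) (F om).
Proof. by case: Fk => _ _ _ Fh _; apply: Fh. Qed.

Lemma omega_linear_wedge r (theta : tup g r -> K^o) om : altmap theta -> valid om ->
  F (wedge theta om) = scalec ((-1) ^+ (r * odd `|k|%N)) (wedge theta (F om)).
Proof. by case: Fk => _ _ _ _ Fw ath v; apply: cochainP; apply: Fw. Qed.

Lemma omega_linear0 : F zeroc = zeroc.
Proof.
rewrite -{1}(scale0c zeroc) omega_linearZ ?scale0c //; exact: valid_zeroc.
Qed.

End Values.

Lemma omega_linear_comp0r V W U k (F : cochain W -> cochain U) (G : cochain V -> cochain W) :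
  omega_linear k F -> omega_linear 0 G -> omega_linear k (fun om => F (G om)).
Proof.
move=> Fk G0; have vG := omega_linear_valid G0.
split=> [om v|om1 om2 v1 v2|a om v|n om v hom|r th om ath v].
- exact: omega_linear_valid Fk _ (vG _ v).
- by rewrite (omega_linearD G0) // (omega_linearD Fk) //; apply: vG.
- by rewrite (omega_linearZ G0) // (omega_linearZ Fk) //; apply: vG.
- rewrite -[n]addr0; apply: (omega_linear_homog Fk (vG _ v)).
  exact: (omega_linear_homog G0 v).
- rewrite (omega_linear_wedge G0) // muln0 expr0 scale1c.
  by rewrite (omega_linear_wedge Fk) //; apply: vG.
Qed.

Lemma omega_linear_comp0l V W U k (F : cochain W -> cochain U) (G : cochain V -> cochain W) :
  omega_linear 0 F -> omega_linear k G -> omega_linear k (fun om => F (G om)).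
Proof.
move=> F0 Gk; have vG := omega_linear_valid Gk.
split=> [om v|om1 om2 v1 v2|a om v|n om v hom|r th om ath v].
- exact: omega_linear_valid F0 _ (vG _ v).
- by rewrite (omega_linearD Gk) // (omega_linearD F0) //; apply: vG.
- by rewrite (omega_linearZ Gk) // (omega_linearZ F0) //; apply: vG.
- rewrite -[n + k]addr0; apply: (omega_linear_homog F0 (vG _ v)).
  exact: (omega_linear_homog Gk v).
- rewrite (omega_linear_wedge Gk) // (omega_linearZ F0); last first.
    by apply: valid_wedge => //; apply: vG.
  by rewrite (omega_linear_wedge F0) ?muln0 ?expr0 ?scale1c //; apply: vG.
Qed.

Lemma omega_linear_id V : omega_linear 0 (fun om : cochain V => om).
Proof.
split=> // [n om _ hom|r th om _ _]; first by rewrite addr0.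
by rewrite muln0 expr0 scale1c.
Qed.

Lemma omega_linear_add V W k (F G : cochain V -> cochain W) :
  omega_linear k F -> omega_linear k G -> omega_linear k (fun om => addc (F om) (G om)).
Proof.
move=> Fk Gk; split=> [om v|om1 om2 v1 v2|a om v|n om v hom|r th om ath v].
- by apply: valid_addc; [apply: (omega_linear_valid Fk)|apply: (omega_linear_valid Gk)].
- rewrite (omega_linearD Fk) // (omega_linearD Gk) // => p q u.
  by rewrite /addc addrACA.
- rewrite (omega_linearZ Fk) // (omega_linearZ Gk) // => p q u.
  by rewrite /addc /scalec scalerDr.
- move=> p q u ne.
  by rewrite /addc (omega_linear_homog Fk v hom) // (omega_linear_homog Gk v hom) // addr0.
- rewrite (omega_linear_wedge Fk) // (omega_linear_wedge Gk) // wedge_addc => p q u.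
  by rewrite /addc /scalec scalerDr.
Qed.

Lemma omega_linear_opp V W k (F : cochain V -> cochain W) :
  omega_linear k F -> omega_linear k (fun om => oppc (F om)).
Proof.
have oppE U (om : cochain U) : oppc om = scalec (-1) om.
  by apply: cochainP => p q u; rewrite /oppc /scalec scaleN1r.
move=> Fk; split=> [om v|om1 om2 v1 v2|a om v|n om v hom|r th om ath v].
- by apply: valid_oppc; apply: (omega_linear_valid Fk).
- rewrite (omega_linearD Fk) // => p q u.
  by rewrite /addc /oppc opprD.
- rewrite (omega_linearZ Fk) // => p q u.
  by rewrite /oppc /scalec scalerN.
- by move=> p q u ne; rewrite /oppc (omega_linear_homog Fk v hom) // oppr0.
- rewrite (omega_linear_wedge Fk) // !oppE wedge_scalec => p q u.
  by rewrite /scalec !scalerA mulrC.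
Qed.

Lemma omega_linear_zero V W k : omega_linear k (fun _ : cochain V => @zeroc K g W).
Proof.
split=> // [om _|om1 om2 _ _ p q u|a om _ p q u|r th om _ _].
- exact: valid_zeroc.
- by rewrite /addc addr0.
- by rewrite /scalec scaler0.
- by rewrite wedge0 scalec0.
Qed.

Lemma valid_incl0 V (v : dg_obj V 0) : valid (incl0 v).
Proof.
move=> p [|q]; last by split=> // u i a x y; rewrite scaler0 addr0.
split=> [u i a x y|u i j]; last by case: p u i j => [|p] u i j; [case: i|].
by case: p u i => [|p] u i; [case: i|rewrite scaler0 addr0].
Qed.

(** * Generation of $\Omega_{\mathfrak g}(\ker d_0)$ by $\ker d_0$ over the forms *)

Section Generation.
Variables (V W : dgmodule g) (e : cochain V -> cochain W).
Hypothesis e0 : omega_linear 0 e.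

Definition in_ker0 (om : cochain V) : Prop :=
  forall p u, dg_d (om p 0%N u) = 0 /\ forall q, om p q.+1 u = 0.

Hypothesis e_ker : forall v, dg_d v = 0 -> f00 e v = 0.

Definition contrc (x : g) (om : cochain V) : cochain V :=
  fun p q u => om p.+1 q (tcons x u).

Lemma big_addcE (I : Type) (r : seq I) (F : I -> cochain V) p q u :
  (\big[addc/zeroc]_(i <- r) F i) p q u = \sum_(i <- r) F i p q u.
Proof. exact: (big_morph (fun o : cochain V => o p q u)). Qed.

(** Induction on the form degree: in degree 0 the cochain is a vector of $\ker d_0$, where [e_ker]
    applies. In degree $n+1$ Euler's identity writes it as a combination of $e^a \wedge
    \iota_{e_a}\omega$, and [e] passes $e^a$. *)
Lemma omega_linear_kills_homog n (om : cochain V) : valid om -> in_ker0 om ->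
  (forall p q u, p != n -> om p q u = 0) -> e om = zeroc.
Proof.
elim: n om => [|n IH] om vom kom hom.
  pose u0 := [ffun i : 'I_0 => 0 : g].
  have -> : om = incl0 (om 0%N 0%N u0).
    apply: cochainP => -[|p] [|q] u; rewrite /incl0 /=.
    - by rewrite (tup0_eq u u0).
    - exact: (kom _ _).2.
    - exact: hom.
    - exact: hom.
  have vi := valid_incl0 (om 0%N 0%N u0).
  (* Total degree 0 leaves only the component $p = q = 0$ of the image, which is the value of
     [f00 e]. *)
  have hi : homog 0 (incl0 (om 0%N 0%N u0)) by move=> [|p] [|q] u.
  apply: cochainP => p q u.
  have [/eqP|ne] := boolP ((p + q)%:Z == 0 + 0); last by rewrite (omega_linear_homog e0 vi hi).
  case: p u => [|p] u; case: q => [|q] // _.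
  by rewrite (tup0_eq u u0); apply: e_ker; apply: (kom _ _).1.
pose b := vbasis (fullv : {vspace g}).
pose S := \big[addc/zeroc]_(a < \dim (fullv : {vspace g}))
  wedge (coord_form a) (contrc b`_a om).
(* Euler's identity: [sum_a e^a /\ iota_(e_a) om = p om] in form degree [p]. *)
have omE : om = scalec n.+1%:R^-1 S.
  apply: cochainP => p q u; rewrite /scalec /S big_addcE.
  under eq_bigr => a _ do rewrite -[wedge _ _ p q u]/(qrow (wedge _ _) q p u) qrow_wedge.
  have := euler_wdg charK u (vom^~ q : validf (qrow om q)).
  rewrite -/b => ->.
  have [pn|np] := eqVneq p n.+1; last by rewrite /qrow hom // !scaler0.
  by rewrite scalerA -pn mulVf ?scale1r // pn (pcharf0P K).1.
have vc x : valid (contrc x om) by move=> p q; apply: altmap_tcons.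
(* Validity is carried along the sum because [e] is additive only on valid cochains. *)
have [vS eS] : valid S /\ e S = zeroc.
  rewrite /S; apply: (big_ind (fun o => valid o /\ e o = zeroc)).
  - by split; [apply: valid_zeroc|apply: (omega_linear0 e0)].
  - move=> o1 o2 [v1 e1] [v2 e2]; split; first exact: valid_addc.
    rewrite (omega_linearD e0) // e1 e2.
    by apply: cochainP => p q u; rewrite /addc addr0.
  move=> a _; split; first by apply: valid_wedge => //; apply: altmap_coord_form.
  rewrite (omega_linear_wedge e0) //; last exact: altmap_coord_form.
  rewrite IH // => [|p u|p q u ne]; last by apply: hom.
    by rewrite wedge0 scalec0.
  by split=> [|q]; [apply: (kom _ _).1|apply: (kom _ _).2].
by rewrite omE (omega_linearZ e0) // eS scalec0.
Qed.

(* [ker d_0] generates [Omega_g (ker d_0)] over the forms; forms of degree above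
   [dim g] vanish, so the decomposition by form degree is finite. *)
Lemma omega_linear_kills_ker0 (om : cochain V) : valid om -> in_ker0 om -> e om = zeroc.
Proof.
move=> vom kom.
pose sel (P : pred nat) : cochain V := fun p q u => if P p then om p q u else 0.
have vsel P : valid (sel P).
  move=> p q; rewrite /sel; case: (P p); [exact: vom|exact: (@valid_zeroc _ _ V)].
have ksel P : in_ker0 (sel P).
  move=> p u; rewrite /sel; case: (P p); first exact: kom.
  by split=> //; apply: (lin0 (@dg_d_is_lin _ _ V _)).
have trunc n : e (sel (fun p => p < n)%N) = zeroc.
  elim: n => [|n IH]; first exact: (omega_linear0 e0).
  have -> : sel (fun p => p < n.+1)%N = addc (sel (fun p => p < n)%N) (sel (pred1 n)).
    apply: cochainP => p q u; rewrite /addc /sel /= ltnS.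
    by case: ltngtP; rewrite ?add0r ?addr0.
  rewrite (omega_linearD e0) // IH (@omega_linear_kills_homog n (sel (pred1 n))) //.
    by apply: cochainP => p q u; rewrite /addc addr0.
  by move=> p q u ne; rewrite /sel /= (negbTE ne).
rewrite -[RHS](trunc (\dim (fullv : {vspace g})).+1); congr e.
apply: cochainP => p q u; rewrite /sel ltnS; case: leqP => // ltp.
exact: altmap_eq0.
Qed.

End Generation.
End OmegaLinear.

(** * The retraction onto the kernel of d_0 *)

Section Retraction.
Variables (K : fieldType) (g : lie_algebra K).
Hypothesis charK : [pchar K] =i pred0.
Variables (V : dgmodule g) (s : forall q, dg_obj V q.+1 -> dg_obj V q).
Hypothesis s_contr : is_contraction s.

Let sl q : lin (@s q). Proof. by case: s_contr. Qed.

Definition hs (om : cochain V) : cochain V :=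
  fun p q u => (-1) ^+ p *: s (om p q.+1 u).
Arguments hs om p q u : clear implicits.

Lemma qrow_hs om q : qrow (hs om) q = sgnf (mapf (@s q) (qrow om q.+1)).
Proof. by []. Qed.

(** The factor $(-1)^p$ in [hs] supplies the sign $(-1)^r$ that a map of degree $-1$ owes when it
    passes an [r]-form. *)
Lemma omega_linear_hs : omega_linear (-1) hs.
Proof.
split=> [om /valid_qrow v|om1 om2 v1 v2 p q u|a om v p q u|n om v hom p q u ne|r th om ath v].
- apply/valid_qrow=> q; rewrite qrow_hs; apply: validf_sgnf.
  by apply: validf_mapf => //; apply: sl.
- by rewrite /hs /addc (linD (@sl q)) scalerDr.
- by rewrite /hs /scalec (linZ (@sl q)) !scalerA mulrC.
- rewrite /hs hom ?(lin0 (@sl q)) ?scaler0 //.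
  by apply: contraNneq ne => <-; rewrite addnS intS [_ - 1]addrC addKr.
- suff -> : hs (wedge th om) = scalec ((-1) ^+ r) (wedge th (hs om)) by rewrite muln1.
  apply: qrowP => q; rewrite qrow_scalec qrow_wedge !qrow_hs qrow_wedge.
  by rewrite (mapf_wdg _ _ (@sl q)) wdg_sgnf scalerA -expr2 sqrr_sign scale1r.
Qed.

Definition s_defect q (x : g) (v : dg_obj V q.+1) : dg_obj V q :=
  dg_act x (s v) - s (dg_act x v).

Lemma s_defect_linr q x : lin (@s_defect q x).
Proof.
move=> a v w; rewrite /s_defect sl !dg_actDr sl scalerBr opprD.
by rewrite addrACA.
Qed.

Lemma s_defect_linl q v : lin (fun x : g => @s_defect q x v).
Proof.
move=> a x y; rewrite /s_defect !dg_actDl sl scalerBr opprD.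
by rewrite addrACA.
Qed.

(** What remains of $1 - (d s + s d)$: zero in positive degrees, and in degree 0 a projection onto
    $\ker d_0$. *)
Definition proj0 q : dg_obj V q -> dg_obj V q :=
  match q with 0 => fun v => v - s (dg_d v) | _.+1 => fun=> 0 end.

Lemma proj0_lin q : lin (@proj0 q).
Proof.
case: q => [|q] a v w /=; last by rewrite scaler0 addr0.
by rewrite dg_d_lin sl scalerBr opprD addrACA.
Qed.

Definition retr (om : cochain V) : cochain V :=
  addc om (oppc (addc (dtot (hs om)) (hs (dtot om)))).

(* Explicit form of [retr], from which its linearity over forms is visible:
   the derivation [dCE] only enters through a commutator. *)
Lemma qrow_retr om q : qrow (retr om) q =
  mapf (@proj0 q) (qrow om q) + sgnf (actf (@s_defect q) (qrow om q.+1)).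
Proof.
rewrite /retr /dtot !(qrow_addc, qrow_oppc) qrow_hs qrow_addc.
rewrite (linD (mapf_lin (@sl q))) (linD (sgnf_lin (M:=_))) !qrow_dCE qrow_hs qrow_dintS.
rewrite addrACA.
rewrite (ce_sgnf_mapf (M:=dg_gmodule V q.+1) (M':=dg_gmodule V q) _ (@sl q)).
rewrite -[actf (fun x v => _) _]/(actf (@s_defect q) (qrow om q.+1)).
rewrite opprD opprK addrCA addrC; congr (_ + _); apply: famP => p u.
rewrite !famE /sgnf /mapf (linZ (@sl q)) scalerA -expr2 sqrr_sign scale1r.
case: q => [|q]; first by rewrite /qrow /= add0r.
rewrite /qrow /= (linZ (@dg_d_is_lin _ _ V _)) scalerA -expr2 sqrr_sign scale1r.
by case: s_contr => _ ->; rewrite subrr.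
Qed.

Lemma omega_linear_retr : omega_linear 0 retr.
Proof.
have lD q := linD (actf_lin (g:=g) (@s_defect_linr q)).
have lZ q := linZ (actf_lin (g:=g) (@s_defect_linr q)).
split=> [om /valid_qrow v|om1 om2 v1 v2|a om v|n om v hom p q u|r th om ath v].
- apply/valid_qrow=> q; rewrite qrow_retr; apply: validfD.
    by apply: validf_mapf => //; apply: proj0_lin.
  by apply: validf_sgnf; apply: validf_actf => //; [apply: s_defect_linr|apply: s_defect_linl].
- suff -> : retr (addc om1 om2) = addc (retr om1) (retr om2) by [].
  apply: qrowP => q; rewrite qrow_addc !qrow_retr !qrow_addc.
  by rewrite (linD (mapf_lin (@proj0_lin q))) lD (linD (sgnf_lin (M:=_))) addrACA.
- suff -> : retr (scalec a om) = scalec a (retr om) by [].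
  apply: qrowP => q; rewrite qrow_scalec !qrow_retr !qrow_scalec.
  by rewrite (linZ (mapf_lin (@proj0_lin q))) lZ (linZ (sgnf_lin (M:=_))) scalerDr.
- rewrite addr0 => ne; rewrite -[LHS]/(qrow (retr om) q p u) qrow_retr famE.
  rewrite /mapf {1}/qrow hom // (lin0 (@proj0_lin q)) add0r /sgnf.
  case: p u ne => [|p] u ne; rewrite ?scaler0 //= big1 ?scaler0 // => i _.
  by rewrite /qrow hom ?(lin0 (@s_defect_linr _ _)) ?scaler0 // addnS.
- suff -> : retr (wedge th om) = wedge th (retr om) by rewrite muln0 expr0 scale1c.
  apply: qrowP => q; rewrite qrow_wedge !qrow_retr !qrow_wedge.
  move/valid_qrow: v => v.
  rewrite (linD (wdg_lin _)) mapf_wdg; last exact: proj0_lin.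
  rewrite actf_wdg //; [|exact: s_defect_linr|exact: s_defect_linl].
  by rewrite (linZ (sgnf_lin (M:=_))) wdg_sgnf.
Qed.

Lemma valid_hs om : valid om -> valid (hs om).
Proof. exact: (omega_linear_valid omega_linear_hs). Qed.

(** Since $d_{\mathrm{tot}}$ squares to zero, both composites of $d_{\mathrm{tot}}$ with
    $d_{\mathrm{tot}} h + h d_{\mathrm{tot}}$ equal $d_{\mathrm{tot}} h d_{\mathrm{tot}}$. *)
Lemma retr_dtot om : valid om -> retr (dtot om) = dtot (retr om).
Proof.
move=> vom; rewrite /retr dtot_addc dtot_oppc dtot_addc !dtot_dtot //; last first.
  exact: valid_hs.
rewrite (omega_linear0 omega_linear_hs).
by apply: cochainP => p q u; rewrite /addc /oppc /zeroc add0r addr0.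
Qed.

Lemma iter_retr_dtot n om : valid om -> iter n retr (dtot om) = dtot (iter n retr om).
Proof.
elim: n om => // n IH om vom; rewrite !iterSr retr_dtot // IH //.
exact: (omega_linear_valid omega_linear_retr).
Qed.

Lemma omega_linear_iter_retr n : omega_linear 0 (iter n retr).
Proof.
elim: n => [|n IH]; first exact: omega_linear_id.
exact: (omega_linear_comp0r omega_linear_retr IH).
Qed.

(** The sum $\sum_{k<n} h E^k$ with $E$ = [retr]. It is a homotopy from $E^n$ to the identity by the
    telescoping sum $1 - E^n = \sum_{k<n} (1-E) E^k$, as $E$ commutes with $d_{\mathrm{tot}}$. *)
Fixpoint hs_iter n (om : cochain V) : cochain V :=
  if n is m.+1 then addc (hs om) (hs_iter m (retr om)) else zeroc.

Lemma omega_linear_hs_iter n : omega_linear (-1) (hs_iter n).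
Proof.
elim: n => [|n IH]; first exact: omega_linear_zero.
apply: omega_linear_add; first exact: omega_linear_hs.
exact: (omega_linear_comp0r IH omega_linear_retr).
Qed.

Lemma dtot0 : dtot (@zeroc K g V) = zeroc.
Proof.
have {1}-> : @zeroc K g V = addc zeroc (oppc zeroc).
  by apply: cochainP => p q u; rewrite /addc /oppc subrr.
rewrite dtot_addc dtot_oppc.
by apply: cochainP => p q u; rewrite /addc /oppc subrr.
Qed.

Lemma retr_homotopy n om : valid om ->
  addc om (oppc (iter n retr om)) = addc (dtot (hs_iter n om)) (hs_iter n (dtot om)).
Proof.
have addcE (o1 o2 : cochain V) p q u : addc o1 o2 p q u = o1 p q u + o2 p q u by [].
have oppcE (o : cochain V) p q u : oppc o p q u = - o p q u by [].
elim: n om => [|n IH] om vom.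
  by rewrite /= dtot0; apply: cochainP => p q u; rewrite !addcE oppcE subrr addr0.
rewrite iterSr /= dtot_addc.
have /IH : valid (retr om) := omega_linear_valid omega_linear_retr vom.
rewrite -retr_dtot // => {}IH; apply: cochainP => p q u.
move/(congr1 (fun o : cochain V => o p q u)): IH.
rewrite !addcE !oppcE => IH; rewrite [RHS]addrACA -IH.
rewrite -[retr om _ _]/(om p q u - (dtot (hs om) p q u + hs (dtot om) p q u)).
by rewrite addrA [X in _ = X - _]addrC subrK.
Qed.

Lemma iter_retr_in_ker0 : exists n, forall om, in_ker0 (iter n retr om).
Proof.
(* Each step lowers by one the bound on the non-zero rows, so [N] steps clear all rows of positive
   internal degree. One more step then acts on row 0 by [proj0] alone, with values in $\ker d_0$. *)
have [N VN] := dg_bounded V; exists N.+1 => om.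
have van k : forall p q u, (N < q.+1 + k)%N -> iter k retr om p q.+1 u = 0.
  elim: k => [|k IH] p q u; first by rewrite addn0 => ltN; apply: VN.
  move=> ltN; rewrite iterS -[LHS]/(qrow (retr _) q.+1 p u) qrow_retr famE.
  rewrite /mapf /= add0r /sgnf; case: p u => [|p] u; rewrite ?scaler0 //=.
  rewrite big1 ?scaler0 // => i _; rewrite /qrow IH; last by rewrite addSnnS.
  by rewrite (lin0 (@s_defect_linr _ _)) scaler0.
move=> p u; split=> [|q]; last by apply: van; rewrite addnS ltnS leq_addl.
rewrite iterS -[X in dg_d X]/(qrow (retr _) 0 p u) qrow_retr famE.
have -> : sgnf (actf (@s_defect 0) (qrow (iter N retr om) 1)) p u = 0.
  rewrite /sgnf; case: p u => [|p] u; rewrite ?scaler0 //=.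
  rewrite big1 ?scaler0 // => i _; rewrite /qrow van //.
  by rewrite (lin0 (@s_defect_linr _ _)) scaler0.
rewrite addr0 /mapf /=; set v := qrow _ _ _ _.
have [_ /(_ 0%N (dg_d v))] := s_contr; rewrite dg_dd (lin0 (@sl 1)) addr0 => ds.
by rewrite (linB (@dg_d_is_lin _ _ V _)) ds subrr.
Qed.

Lemma retr_id om : in_ker0 om -> retr om = om.
Proof.
move=> kom; apply: cochainP => p q u.
rewrite -[LHS]/(qrow (retr om) q p u) qrow_retr famE.
have -> : sgnf (actf (@s_defect q) (qrow om q.+1)) p u = 0.
  rewrite /sgnf; case: p u => [|p] u; rewrite ?scaler0 //=.
  rewrite big1 ?scaler0 // => i _; rewrite /qrow (kom _ _).2.
  by rewrite (lin0 (@s_defect_linr _ _)) scaler0.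
rewrite addr0 /mapf /qrow; case: q => [|q] /=; last by rewrite (kom _ _).2.
by rewrite (kom _ _).1 (lin0 (@sl 0)) subr0.
Qed.

Lemma iter_retr_id n om : in_ker0 om -> iter n retr om = om.
Proof. by move=> kom; elim: n => //= n ->; apply: retr_id. Qed.

End Retraction.

(** * Weak morphisms out of a resolution: homotopies and lifts *)

Section WeakMorphisms.
Variables (K : fieldType) (g : lie_algebra K).
Hypothesis charK : [pchar K] =i pred0.
Variable V : dgmodule g.
Hypothesis acV : acyclic_pos V.

Lemma weak_morphism_dtot (W : dgmodule g) (f : cochain V -> cochain W) om :
  weak_morphism f -> valid om -> f (dtot om) = dtot (f om).
Proof. by case=> _ fd vom; apply: cochainP; apply: fd. Qed.

Lemma weak_morphisms_homotopic (W : dgmodule g) (f f' : cochain V -> cochain W) :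
  weak_morphism f -> weak_morphism f' ->
  (forall v, dg_d v = 0 -> f00 f v = f00 f' v) -> homotopic f f'.
Proof.
move=> wf wf' ff'; have [s sP] := exists_contraction acV.
have [n nP] := iter_retr_in_ker0 sP.
pose e om := addc (f' om) (oppc (f om)).
have e0 : omega_linear 0 e.
  by apply: omega_linear_add; [case: wf'|apply: omega_linear_opp; case: wf].
have ed om : valid om -> e (dtot om) = dtot (e om).
  by move=> vom; rewrite /e !(weak_morphism_dtot _ vom) // dtot_addc dtot_oppc.
have h1 := omega_linear_hs_iter charK sP n.
exists (fun om => e (hs_iter s n om)); split; first exact: omega_linear_comp0l e0 h1.
move=> om vom; rewrite -/(e om).
have vh := omega_linear_valid h1 vom.
have vhd := omega_linear_valid h1 (valid_dtot vom).
have vi := omega_linear_valid (omega_linear_iter_retr charK sP n) vom.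
(* Applying [e] to this splitting kills the first term, which lies in $\Omega_{\mathfrak g}(\ker
   d_0)$. The other two give the homotopy relation, since [e] commutes with $d_{\mathrm{tot}}$. *)
have omE : om = addc (iter n (retr s) om)
    (addc (dtot (hs_iter s n om)) (hs_iter s n (dtot om))).
  rewrite -(retr_homotopy charK sP n vom); apply: cochainP => p q u.
  by rewrite /addc /oppc addrC subrK.
rewrite {1}omE (omega_linearD e0) //; last by apply: valid_addc => //; apply: valid_dtot.
rewrite (omega_linearD e0) //; last exact: valid_dtot.
rewrite (omega_linear_kills_ker0 charK e0 _ vi (nP om)); last first.
  by move=> v dv; rewrite /f00 /e /addc /oppc -!/(f00 _ v) ff' // subrr.
by rewrite ed // => p q u; rewrite /addc add0r.
Qed.

Lemma incl0_in_ker0 (v : dg_obj V 0) : dg_d v = 0 -> in_ker0 (incl0 v).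
Proof.
move=> dv p u; split=> //=; case: p u => [|p] u //=.
exact: (lin0 (@dg_d_is_lin _ _ V _)).
Qed.

(** The image has total degree 0, and both gradings are non-negative, so it is concentrated at $p =
    q = 0$. Thus [f00] respects composition. *)
Lemma weak_morphism_incl0 (U W : dgmodule g) (f : cochain U -> cochain W) v :
  omega_linear 0 f -> f (incl0 v) = incl0 (f00 f v).
Proof.
move=> f0; apply: cochainP => p q u.
have hi : homog 0 (incl0 v) by move=> [|p'] [|q'].
have [/eqP|ne] := boolP ((p + q)%:Z == 0 + 0).
  by case: p u => [|p] u; case: q => [|q] // _; rewrite (tup0_eq u [ffun=> 0]).
rewrite (omega_linear_homog f0 (valid_incl0 v) hi) //.
by case: p u ne => [|p] u; case: q.
Qed.

(** Equivariance of [X] on $\ker d_0$ suffices, because [X] is applied after the power of [retr]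
    that brings all values into $\ker d_0$. *)
Lemma weak_morphism_lift (W : dgmodule g) (X : dg_obj V 0 -> dg_obj W 0) :
  lin X -> (forall v, dg_d v = 0 -> dg_d (X v) = 0) ->
  (forall x v, dg_d v = 0 -> X (dg_act x v) = dg_act x (X v)) ->
  exists f : cochain V -> cochain W,
    weak_morphism f /\ forall v, dg_d v = 0 -> f00 f v = X v.
Proof.
move=> Xl Xd Xg; have [s sP] := exists_contraction acV.
have [n nP] := iter_retr_in_ker0 sP.
pose X' q : dg_obj V q -> dg_obj W q := if q is 0 then X else fun=> 0.
have X'l q : lin (X' q) by case: q => [|q] //= a v w; rewrite scaler0 addr0.
pose chi (om : cochain V) : cochain W := fun p q u => X' q (om p q u).
have qchi om q : qrow (chi om) q = mapf (X' q) (qrow om q) by [].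
have chi0 : omega_linear 0 chi.
  split=> [om v p q|om1 om2 _ _ p q u|a om _ p q u|m om _ hom p q u|r th om _ _].
  - exact: altmap_map.
  - exact: (linD (X'l q)).
  - exact: (linZ (X'l q)).
  - by rewrite addr0 => ne; rewrite /chi hom // (lin0 (X'l q)).
  - rewrite muln0 expr0 scale1c.
    suff -> : chi (wedge th om) = wedge th (chi om) by [].
    by apply: qrowP => q; rewrite qrow_wedge !qchi qrow_wedge mapf_wdg.
have i0 := omega_linear_iter_retr charK sP n.
exists (fun om => chi (iter n (retr s) om)); split; last first.
  by move=> v dv; rewrite /f00 (iter_retr_id sP) //; apply: incl0_in_ker0.
split=> [|om vom]; first exact: omega_linear_comp0r chi0 i0.
rewrite (iter_retr_dtot charK sP) //; move: (nP om); set o := iter _ _ _ => ko.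
suff -> : chi (dtot o) = dtot (chi o) by [].
have dz p q u : dCE (chi o) p q.+1 u = 0.
  rewrite -[LHS]/(qrow (dCE (chi o)) q.+1 p u) qrow_dCE.
  have -> : qrow (chi o) q.+1 = 0 by apply: famP => p' u'; rewrite famE.
  by rewrite (lin0 (ce_lin (M:=dg_gmodule W q.+1))) famE.
(* In positive rows both sides vanish: [chi] is zero there, and in row 1 the internal differential
   meets values of [X], which are closed. In row 0 both sides are Chevalley-Eilenberg sums, matched
   by the equivariance of [X]. *)
apply: cochainP => p [|q] u; last first.
  rewrite /dtot /addc dz add0r /chi /=; case: q => [|q] /=.
    by rewrite Xd ?scaler0 //; apply: (ko _ _).1.
  by rewrite (lin0 (@dg_d_is_lin _ _ W _)) scaler0.
- rewrite {1}/chi /dtot /addc /= !addr0; case: p u => [|p] u; first exact: (lin0 Xl).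
  rewrite /dCE (linD Xl) !(lin_sum Xl); congr (_ + _); apply: eq_bigr => i _.
    by rewrite (linZ Xl) Xg //; apply: (ko _ _).1.
  by rewrite (lin_sum Xl); apply: eq_bigr => j _; rewrite (linZ Xl).
Qed.

End WeakMorphisms.

(** * Existence and uniqueness of the dg lift *)

Theorem theorem1p22 (K : fieldType) (g : lie_algebra K)
    (G H : LPmodule g) (V W : dgmodule g)
    (alpha : cochain V -> cochain (adj_dg g))
    (beta : cochain W -> cochain (adj_dg g))
    (psiV : G -> dg_obj V 0) (psiW : H -> dg_obj W 0) :
  [pchar K] =i pred0 ->
  weak_morphism alpha -> weak_morphism beta ->
  dg_lift_via alpha psiV -> dg_lift_via beta psiW ->
  acyclic_pos V ->
  forall phi : G -> H, LP_morphism phi ->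
  exists f : cochain V -> cochain W,
    [/\ weak_morphism f,
        homotopic (fun om => beta (f om)) alpha,
        (forall x, f00 f (psiV x) = psiW (phi x)) &
        (forall f' : cochain V -> cochain W,
           weak_morphism f' -> homotopic (fun om => beta (f' om)) alpha ->
           (forall x, f00 f' (psiV x) = psiW (phi x)) ->
           homotopic f f')].
Proof.
move=> charK walpha wbeta [Vl Vg Vinj Vker Valpha] [Wl Wg Winj Wker Wbeta] acV phi.
case=> phil phig phiX.
have [s sP] := exists_contraction acV; have [sl _] := sP.
have pker (v : dg_obj V 0) : dg_d (v - s 0%N (dg_d v)) = 0.
  have [_ /(_ 0%N (dg_d v))] := sP; rewrite dg_dd (lin0 (sl 1%N)) addr0 => ds.
  by rewrite (linB (@dg_d_is_lin _ _ V _)) ds subrr.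
(* [inv] is the projection $1 - s d$ onto $\ker d_0$ followed by the inverse of [psiV]. It extends
   that inverse linearly to all of $V^0$, as [weak_morphism_lift] requires. *)
have /choice[inv invP] : forall v, exists x, psiV x = v - s 0%N (dg_d v).
  by move=> v; apply/Vker; apply: pker.
have inv_id x : inv (psiV x) = x.
  have dx : dg_d (psiV x) = 0 by apply/Vker; exists x.
  by apply: Vinj; rewrite invP dx (lin0 (sl _)) subr0.
have inv_lin : lin inv.
  move=> a v w; apply: Vinj; rewrite Vl !invP dg_d_lin sl.
  by rewrite scalerBr opprD addrACA.
have [] := @weak_morphism_lift _ _ charK V acV W (fun v => psiW (phi (inv v))).
- by move=> a v w; rewrite inv_lin phil Wl.
- by move=> v _; apply/Wker; exists (phi (inv v)).
- by move=> x v /Vker[y <-]; rewrite -Vg !inv_id phig Wg.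
move=> f [wf fX]; have [f0 fd] := wf.
have fpsi x : f00 f (psiV x) = psiW (phi x).
  by rewrite fX ?inv_id //; apply/Vker; exists x.
exists f; split=> // [|f' wf' _ f'psi]; last first.
  apply: weak_morphisms_homotopic => // v /Vker[x <-].
  by rewrite fpsi f'psi.
(* The target is now $\mathfrak g$ in degree 0: on $\ker d_0$, identified with $G$, the composite is
   $Y \circ \varphi$ and [alpha] is $X$, and these agree as [phi] is a morphism of Loday-Pirashvili
   modules. *)
apply: weak_morphisms_homotopic => // [|v /Vker[x <-]].
  have [b0 bd] := wbeta; split; first exact: omega_linear_comp0r b0 f0.
  move=> om vom; rewrite (weak_morphism_dtot wf vom).
  by apply: bd; apply: (omega_linear_valid f0).
rewrite Valpha -phiX -Wbeta -fpsi /f00.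
by rewrite (weak_morphism_incl0 _ f0).
Qed.
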